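(* Let $W$ be a finite Coxeter group with simple reflections $S$ and $L\subseteq S$. Suppose that $N_L$ centralizes $W_L$ (i.e. $W_L$ is bulky, $N_W(W_L)=W_L\times N_L$), and suppose that for each $W_L$-conjugacy class $C$ of cuspidal elements of $W_L$ with fixed representative $w_C$ there are linear characters $\varphi_{w_C},\psi_{w_C}$ of $C_{W_L}(w_C)$ with $\Phi_L=\sum_{C\in\mathcal C_L}\operatorname{Ind}_{C_{W_L}(w_C)}^{W_L}\varphi_{w_C}$, $\Psi_L=\sum_{C\in\mathcal C_L}\operatorname{Ind}_{C_{W_L}(w_C)}^{W_L}\psi_{w_C}$ and $\psi_{w_C}=\varphi_{w_C}\epsilon$. Then $\widetilde\varphi_{w_C}:=\varphi_{w_C}\times 1_{N_L}$ and $\widetilde\psi_{w_C}:=\psi_{w_C}\times1_{N_L}$ are linear characters of $C_W(w_C)=C_{W_L}(w_C)\times N_L$ satisfying $\widetilde\Phi_L=\sum_{C\in\mathcal C_L}\operatorname{Ind}_{C_W(w_C)}^{N_W(W_L)}\widetilde\varphi_{w_C}$, $\widetilde\Psi_L=\sum_{C\in\mathcal C_L}\operatorname{Ind}_{C_W(w_C)}^{N_W(W_L)}\widetilde\psi_{w_C}$, and $\widetilde\psi_{w_C}=\widetilde\varphi_{w_C}\epsilon\alpha_L$ for all $C\in\mathcal C_L$.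
   Context: $W$ has length function $\ell$ and acts on the right as a reflection group on $V=\mathbb R^{|S|}$ (and $V_{\mathbb C}$); $x^w=w^{-1}xw$, $J^w=\{s^w:s\in J\}$; $\epsilon$ is the sign character, $1_U$ the trivial character of $U$. For $J\subseteq S$: $W_J=\langle J\rangle$; $X_J=\{w:\ell(sw)>\ell(w)\ \forall s\in J\}$; $x_J=\sum_{x\in X_J}x^{-1}$; $X_J^\sharp=\{x\in X_J:J^x\subseteq S\}$; $N_J=\{x\in X_J:J^x=J\}$, a subgroup with $N_W(W_J)=W_J\rtimes N_J$. With $m_{KL}=|X_K\cap X_L^\sharp|$ if $L\subseteq K$, else $0$ (invertible), define $e_L$ by $x_K=\sum_Lm_{KL}e_L$; $e_L^L$ is the same element computed in $(W_L,L)$. $\Phi_L$ is the character of $W_L$ on $e_L^L\mathbb CW_L$ (right multiplication); $\widetilde\Phi_L$ is the character of $N_W(W_L)$ on $e_L\mathbb CW_L$. Orlik–Solomon algebra: $T$ reflections, $H_t$ hyperplanes; $A(W)$ generated by $a_t$ with $a_ta_{t'}=-a_{t'}a_t$ and $\sum_{i=1}^p(-1)^ia_{t_1}\cdots\widehat{a_{t_i}}\cdots a_{t_p}=0$ for linearly dependent $\{H_{t_i}\}$; $W$ acts by $a_t.w=a_{t^w}$. $\Psi_L$ is the character of $W_L$ on the top component of the Orlik–Solomon algebra of $W_L$ (span of products $a_{t_1}\cdots a_{t_{p}}$ of generators for reflections of $W_L$ with $\bigcap H_{t_i}=\operatorname{Fix}(W_L)$, $p$ its codimension). For $X=\operatorname{Fix}(W_L)$,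 $A_X\subseteq A(W)$ is the span of such products with $\bigcap H_{t_i}=X$, and $\widetilde\Psi_L$ is the character of $N_W(W_L)$ on $A_X$. $\alpha_L(w)=\det(w|_{\operatorname{Fix}(W_L)})$ for $w\in N_W(W_L)$. $w\in W_L$ is cuspidal in $W_L$ if it has no nonzero fixed vector in the orthogonal complement of $\operatorname{Fix}(W_L)$; $\mathcal C_L$ is the set of $W_L$-classes of cuspidal elements of $W_L$. *)

(* Defs.v *)
From HB Require Import structures.
From mathcomp Require Import all_boot all_order all_algebra all_fingroup all_solvable all_field all_character.
Set Implicit Arguments. Unset Strict Implicit. Unset Printing Implicit Defensive.
Import Order.TTheory GRing.Theory Num.Theory.
Local Open Scope ring_scope.

Section Coxeter.
Variable gT : finGroupType.

Definition Sset n (s : 'I_n -> gT) : {set gT} := [set s i | i : 'I_n].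
Definition Wgrp n (s : 'I_n -> gT) : {group gT} := <<Sset s>>%G.

Definition coxeter_matrix n (m : 'I_n -> 'I_n -> nat) : Prop :=
  [/\ forall i, m i i = 1%N, forall i j, m i j = m j i
    & forall i j, i != j -> (2 <= m i j)%N].

(* Gram matrix of the geometric representation: B(a_i,a_j) = - cos(pi/m_ij);
   cos(pi/k) = Re((k).-root (-1)) since k.-root(-1) = exp(i pi/k). *)
Definition cox_gram n (m : 'I_n -> 'I_n -> nat) : 'M[algC]_n :=
  \matrix_(i, j) (- 'Re ((m i j).-root (-1 : algC))).

(* the reflection s_i acting on the right on row vectors (coordinates
   in the basis of simple roots):  v.s_i = v - 2 B(v,a_i) a_i *)
Definition refl_mx n (m : 'I_n -> 'I_n -> nat) (i : 'I_n) : 'M[algC]_n :=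
  \matrix_(j, k) ((j == k)%:R - 2 * cox_gram m j i * (k == i)%:R).

Definition powg (A : {set gT}) (k : nat) : {set gT} :=
  iter k (fun B => (B * A)%g) [set 1%g].
Definition len (A : {set gT}) (w : gT) : nat :=
  find (fun k => w \in powg A k) (iota 0 #|gT|.+1).

Definition Xset (A K : {set gT}) : {set gT} :=
  [set w in <<A>>%g | [forall t in K, len A w < len A (t * w)%g]%N].
Definition Xsharp (A K : {set gT}) : {set gT} :=
  [set x in Xset A K | (K :^ x)%g \subset A].
Definition Nset (A K : {set gT}) : {set gT} :=
  [set x in Xset A K | (K :^ x)%g == K].

Definition sgn (A : {set gT}) (w : gT) : algC := (-1) ^+ len A w.

Definition gel (i : 'I_#|gT|) : gT := enum_val i.
Definition setv (i : 'I_#|{: {set gT}}|) : {set gT} := enum_val i.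

Definition gv (x : gT) : 'rV[algC]_#|gT| := delta_mx 0 (enum_rank x).
Definition rmul (x : gT) : 'M[algC]_#|gT| :=
  \matrix_(i, j) ((gel i * x)%g == gel j)%:R.

Definition xel (A K : {set gT}) : 'rV[algC]_#|gT| :=
  \sum_(x in Xset A K) gv (x^-1)%g.
Definition mKL (A K L : {set gT}) : nat :=
  if L \subset K then #|Xset A K :&: Xsharp A L| else 0%N.
Definition Mmat (A : {set gT}) : 'M[algC]_#|{: {set gT}}| :=
  \matrix_(i, j) (if (setv i \subset A) && (setv j \subset A)
                  then (mKL A (setv i) (setv j))%:R
                  else (i == j)%:R).
Definition Xmat (A : {set gT}) : 'M[algC]_(#|{: {set gT}}|, #|gT|) :=
  \matrix_(i < #|{: {set gT}}|)
     (if setv i \subset A then xel A (setv i) else 0).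
(* e_L computed in (<<A>>, A):  x_K = sum_L m_KL e_L *)
Definition eel (A L : {set gT}) : 'rV[algC]_#|gT| :=
  row (enum_rank L) (invmx (Mmat A) *m Xmat A).

(* trace of (the restriction to the stable subspace U of) the map v |-> v *m M *)
Definition tr_on k (U : 'M[algC]_k) (M : 'M[algC]_k) : algC :=
  \tr (row_base U *m M *m pinvmx (row_base U)).
Definition det_on k (U : 'M[algC]_k) (M : 'M[algC]_k) : algC :=
  \det (row_base U *m M *m pinvmx (row_base U)).

(* character of <<L>>-elements / normalizer elements on e^A_L C<<L>> *)
Definition Echar (A L : {set gT}) (w : gT) : algC :=
  tr_on (\sum_(v in <<L>>%g) <<eel A L *m rmul v>>)%MS (rmul w).

Definition Fixmx n (rho : gT -> 'M[algC]_n) (L : {set gT}) : 'M[algC]_n :=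
  (\bigcap_(v in <<L>>%g) kermx (rho v - 1%:M))%MS.
Definition alphaL n (rho : gT -> 'M[algC]_n) (L : {set gT}) (w : gT) : algC :=
  det_on (Fixmx rho L) (rho w).
Definition cuspidal n (m : 'I_n -> 'I_n -> nat) (rho : gT -> 'M[algC]_n)
    (L : {set gT}) (w : gT) : bool :=
  [&& w \in <<L>>%g &
   \rank (kermx (rho w - 1%:M) :&: kermx (cox_gram m *m (Fixmx rho L)^T))%MS
     == 0%N].

Notation Ed := #|{: {set gT}}|.
Definition ev (S : {set gT}) : 'rV[algC]_Ed := delta_mx 0 (enum_rank S).
Definition coef (u : 'rV[algC]_Ed) (S : {set gT}) : algC := u 0 (enum_rank S).
Definition ltg (t u : gT) : bool := (enum_rank t < enum_rank u)%N.
Definition monw (A B : {set gT}) : 'rV[algC]_Ed :=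
  if [disjoint A & B]
  then (-1) ^+ #|[set p in setX A B | ltg p.2 p.1]| *: ev (A :|: B)
  else 0.
Definition wedge (u v : 'rV[algC]_Ed) : 'rV[algC]_Ed :=
  \sum_(A : {set gT}) \sum_(B : {set gT}) (coef u A * coef v B) *: monw A B.
(* boundary of the monomial of S (elements ordered by enum_rank) *)
Definition bd (S : {set gT}) : 'rV[algC]_Ed :=
  \sum_(t in S) (-1) ^+ #|[set u in S | ltg u t]| *: ev (S :\ t).
Definition hypint n (rho : gT -> 'M[algC]_n) (S : {set gT}) : 'M[algC]_n :=
  (\bigcap_(t in S) kermx (rho t - 1%:M))%MS.
(* the hyperplanes H_t, t in S, are linearly dependent: codim of their
   intersection is < |S| *)
Definition dependent n (rho : gT -> 'M[algC]_n) (S : {set gT}) : bool :=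
  (n < \rank (hypint rho S) + #|S|)%N.
Definition OSideal n (rho : gT -> 'M[algC]_n) (T : {set gT}) : 'M[algC]_Ed :=
  (\sum_(A : {set gT} | A \subset T)
     \sum_(S : {set gT} | (S \subset T) && dependent rho S)
        <<wedge (ev A) (bd S)>>)%MS.
Definition OSmono n (rho : gT -> 'M[algC]_n) (T : {set gT}) (X : 'M[algC]_n)
  : 'M[algC]_Ed :=
  (\sum_(S : {set gT} | [&& S \subset T, (hypint rho S == X)%MS
                            & #|S| + \rank X == n]%N) <<ev S>>)%MS.
Definition mono_img (g : gT) (S : {set gT}) : 'rV[algC]_Ed :=
  foldr (fun t acc => wedge (ev [set (t ^ g)%g]) acc) (ev set0) (enum S).
Definition OSact (g : gT) : 'M[algC]_Ed :=
  \matrix_(i < Ed) mono_img g (setv i).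
(* character of g on the component A_X of the OS algebra A(T) = E(T)/I(T):
   trace on (M_X + I)/I = trace on M_X + I minus trace on I *)
Definition OSchar n (rho : gT -> 'M[algC]_n) (T : {set gT}) (X : 'M[algC]_n)
    (g : gT) : algC :=
  tr_on (OSmono rho T X + OSideal rho T)%MS (OSact g)
  - tr_on (OSideal rho T) (OSact g).

Definition refls (A : {set gT}) : {set gT} :=
  [set (t ^ w)%g | t in A, w in <<A>>%g].

End Coxeter.

(* Main.v *)
Require Import Defs.
From mathcomp Require Import all_boot all_order all_algebra all_fingroup all_solvable all_field all_character.
From mathcomp Require Import zify ring.
Set Implicit Arguments. Unset Strict Implicit. Unset Printing Implicit Defensive.
Import Order.TTheory GRing.Theory Num.Theory.
Local Open Scope ring_scope.

(** Since N_L centralizes W_L, every element of N_W(W_L) is u x with u in W_L and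
    x in N_L, and each of the two characters of N_W(W_L) takes at u x the value
    of its analogue for W_L at u.

    Left multiplication by e_L is an isomorphism of right W_L-modules from
    e_L^L C W_L to e_L C W_L, because e_L and e_L^L are both annihilated on the
    right by x_K^L for every proper subset K of L.  The annihilation follows from
    the formula: e_H x_K^L is the sum over I in K of #{z in X_K^L : I^z = H} e_I,
    which is a Mackey decomposition of x_H x_K^L.  Moreover e_L x = e_L for
    x in N_L, as x fixes the simple roots of L.

    The monomials spanning A_X only involve reflections fixing X pointwise, and
    these are the reflections of W_L; the projection of the exterior algebra onto
    the monomials in these reflections maps the Orlik-Solomon ideal of W to that
    of W_L.

    Finally C_W(w) normalizes W_L for w cuspidal in W_L, since then
    Fix(w) = Fix(W_L), and the determinant of x in N_L on Fix(W_L) is its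
    determinant on V. *)

(** * Roots of -1 *)

(** The hypotheses present W as a finite group with a faithful representation by the reflections of
    a Gram matrix; the relations between the simple reflections, the sign of a root and the
    nondegeneracy of the form all have to be derived. Length is traded for positivity of roots,
    because in that form the condition defining X_K does not mention the ambient group, so that
    objects computed in W_L can be compared with those of W. The base of this is dihedral and needs
    sin(k pi/m) >= 0, while pi/m enters only through [m.-root (-1)], the root of -1 of largest real
    part in the closed upper half plane. Finiteness of W supplies the rest: an element acting as 1 +
    N with N^2 = 0 is trivial, and averaging over W shows that the form is nondegenerate. On the
    Orlik-Solomon side the obstacle is that the character is a difference of two traces involving
    the whole ideal; the second isomorphism theorem replaces the ideal by its intersection with the
    span of the relevant monomials. *)

Lemma norm1_Re_Im (z : algC) : `|z| = 1 -> 'Re z ^+ 2 + 'Im z ^+ 2 = 1.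
Proof. by move=> z1; rewrite -normC2_Re_Im z1 expr1n. Qed.

Lemma norm1_Im0 (z : algC) : `|z| = 1 -> 'Im z = 0 -> z = 1 \/ z = -1.
Proof.
move=> z1 im0; have := norm1_Re_Im z1; rewrite im0 expr0n addr0 => /eqP.
rewrite sqrf_eq1 [in z = 1](Crect z) [in z = -1](Crect z) im0 mulr0 addr0.
by case/orP=> /eqP; [left|right].
Qed.

(** Cosine decreases on [0, pi]: multiplication by [v] increases the angle of [u], and the angle
    stays at most pi. *)
Lemma Re_mul_lt (u v : algC) : `|u| = 1 -> `|v| = 1 -> 0 < 'Im u -> 0 < 'Im v ->
  0 <= 'Im (u * v) -> 'Re (u * v) < 'Re u.
Proof.
move=> u1 v1 bu dv; rewrite ReM ImM.
have := norm1_Re_Im v1; have ru := Creal_Re u; have rv := Creal_Re v.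
move: bu dv ru rv; move: ('Re u) ('Im u) ('Re v) ('Im v) => a b c d b0 d0 ra rc.
move=> cd1 im0.
have c1 : 0 < 1 - c.
  rewrite subr_gt0 real_ltNge ?rpred1 //; apply/negP => lec.
  have : 1 < c ^+ 2 + d ^+ 2.
    by rewrite -[1]addr0 ler_ltD ?exprn_gt0 // -[1](expr1n _ 2) lerXn2r ?qualifE /= ?ler01 // (le_trans ler01).
  by rewrite cd1 ltxx.
(* Multiplied by [d] = Im v, the difference of the real parts is (1 - c) Im (u v) + b (1 - c), up to
   a multiple of |v|^2 - 1 = 0. *)
rewrite -subr_gt0 -(pmulr_rgt0 _ d0).
have -> : d * (a - (a * c - b * d)) = (1 - c) * (a * d + c * b) + b * (1 - c) + b * (c ^+ 2 + d ^+ 2 - 1) by ring.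
by rewrite cd1 subrr mulr0 addr0 ltr_wpDl ?mulr_ge0 ?mulr_gt0 // ltW.
Qed.

Section RootOfMinusOne.
Variables (m : nat) (m_gt1 : (1 < m)%N).
Let z : algC := m.-root (-1).

Let zm : z ^+ m = -1. Proof. by rewrite rootCK // ltnW. Qed.

Lemma norm_rootN1 : `|z| = 1.
Proof. by rewrite norm_rootC normrN1 rootC1 // ltnW. Qed.

Lemma rootN1_Re_max (y : algC) : y ^+ m = -1 -> 0 <= 'Im y -> 'Re y <= 'Re z.
Proof. by apply: rootC_Re_max; apply: ltnW. Qed.

(** If z were real it would be -1, which has the least real part on the unit circle; by maximality
    -1 would be the only root of -1 in the closed upper half plane. For a primitive m-th root of
    unity w, however, -w or its conjugate is another one. *)
Lemma Im_rootN1_gt0 : 0 < 'Im z.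
Proof.
rewrite lt_def Im_rootC_ge0 // andbT; apply/eqP=> /(norm1_Im0 norm_rootN1) [] z1.
  by move: zm; rewrite z1 expr1n => /esym/eqP; rewrite eqNr oner_eq0.
have [w pw] := C_prim_root_exists (ltnW m_gt1).
have yP (y : algC) : y ^+ m = -1 -> 0 <= 'Im y -> y = -1.
  move=> ym imy; have y1 : `|y| = 1.
    by apply/eqP; rewrite -(@pexpr_eq1 _ _ m) ?(ltnW m_gt1) // -normrX ym normrN1.
  have := rootN1_Re_max ym imy; rewrite z1 raddfN /= (Creal_ReP 1 _) ?rpred1 // => reN.
  have im0 : 'Im y = 0.
    apply/eqP; rewrite -sqrf_eq0 eq_le real_exprn_even_ge0 ?Creal_Im // andbT.
    have := norm1_Re_Im y1 => /(canRL (addKr _)) ->.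
    have h1 : 1 <= - 'Re y by rewrite lerNr.
    by rewrite addrC subr_le0 -sqrrN -[1](expr1n _ 2) lerXn2r ?qualifE /= ?ler01 // (le_trans ler01).
  case: (norm1_Im0 y1 im0) => // y1'; move: ym; rewrite y1' expr1n.
  by move/esym/eqP; rewrite eqNr oner_eq0.
have wm := prim_expr_order pw.
have Nm : (-1 : algC) ^+ m = -1 by rewrite -{1}z1 zm.
have w1 : w = 1.
  have Nw : (- w) ^+ m = -1 by rewrite exprNn wm mulr1.
  have Nwc : (- w^*) ^+ m = -1.
    by rewrite -rmorphN -rmorphXn /= Nw rmorphN rmorph1.
  have [imw|imw] := real_leP (@real0 _) (Creal_Im (- w)).
    by apply: oppr_inj; apply: yP.
  apply/eqP; rewrite -(inj_eq (fmorph_inj (@Num.conj algC))) rmorph1; apply/eqP.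
  by apply: oppr_inj; apply: yP => //; rewrite -rmorphN Im_conj oppr_ge0 ltW.
by have := prim_order_dvd pw 1; rewrite expr1 w1 eqxx dvdn1 => /eqP m1; move: m_gt1; rewrite m1.
Qed.

(** This stands in for z = exp(i pi/m): with t the angle of z, sin (k t) >= 0 for k <= j. The
    exponent j is the least one with z^j = -1. *)
Lemma rootN1_pow : exists2 j, (0 < j)%N & z ^+ j = -1 /\
  (forall k, (k <= j)%N -> 0 <= 'Im (z ^+ k)).
Proof.
have exj : exists j, z ^+ j == -1 by exists m; rewrite zm.
have N1 : (1 : algC) <> -1 by move/esym/eqP; rewrite eqNr oner_eq0.
case: (ex_minnP exj) => j /eqP zj minj; exists j.
  by rewrite lt0n; apply/eqP => j0; apply: N1; rewrite -zj j0.
split=> //; elim=> [|k IHk] lekj; first by rewrite expr0 (Creal_ImP 1 _) ?rpred1.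
have imk := IHk (ltnW lekj); rewrite real_leNgt ?real0 ?Creal_Im //; apply/negP => imS.
have n1 i : `|z ^+ i| = 1 by rewrite normrX norm_rootN1 expr1n.
have bk : 0 < 'Im (z ^+ k).
  rewrite lt_def imk andbT; apply/eqP => /(norm1_Im0 (n1 k)) [] zk.
    by move: imS; rewrite exprS zk mulr1 => /lt_trans /(_ Im_rootN1_gt0); rewrite ltxx.
  by have := minj k; rewrite zk eqxx => /(_ isT); rewrite leqNgt lekj.
(* If Im z^(k+1) < 0 <= Im z^k, then z = u v with u, v in the open upper half
   plane and one of u, v a larger root of -1. *)
pose u := - (z ^+ k)^*; pose v := - z ^+ k.+1.
have uv : u * v = z.
  by rewrite /u /v mulrNN exprSr mulrA [_^* * _]mulrC -normCK n1 expr1n mul1r.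
have u1 : `|u| = 1 by rewrite normrN norm_conjC n1.
have v1 : `|v| = 1 by rewrite normrN n1.
have imu : 0 < 'Im u by rewrite raddfN /= Im_conj opprK.
have imv : 0 < 'Im v by rewrite raddfN /= oppr_gt0.
have imz := Im_rootN1_gt0.
have lu : 'Re z < 'Re u by rewrite -uv; apply: Re_mul_lt; rewrite ?uv // ltW.
have lv : 'Re z < 'Re v by rewrite -uv mulrC; apply: Re_mul_lt; rewrite // mulrC uv ltW.
(* Both u^m and v^m are signs and their product is -1, so one of u, v is a root of -1. *)
have vm : v ^+ m = (-1) ^+ (m + k.+1).
  by rewrite [v ^+ m]exprNn -exprM mulnC exprM zm exprD.
have um : u ^+ m * v ^+ m = -1 by rewrite -exprMn uv.
rewrite -signr_odd in vm; case: (odd _) vm um => /= [vm _ | -> um].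
  by have := rootN1_Re_max vm (ltW imv); rewrite (lt_geF lv).
by rewrite mulr1 in um; have := rootN1_Re_max um (ltW imu); rewrite (lt_geF lu).
Qed.

End RootOfMinusOne.

(** * Traces on subspaces *)

(** Two triangular factorizations of the block matrix with rows (1, -A) and (B, 1). *)
Lemma det_Sylvester (R : comPzRingType) p q (A : 'M[R]_(p, q)) (B : 'M[R]_(q, p)) :
  \det (1%:M + A *m B) = \det (1%:M + B *m A).
Proof.
have e1 : block_mx 1%:M (- A) B 1%:M =
   block_mx (1%:M + A *m B) (- A) 0 1%:M *m block_mx 1%:M 0 B 1%:M.
  by rewrite mulmx_block !(mulmx1, mulmx0, mul0mx, mul1mx, add0r, addr0) mulNmx addrK.
have e2 : block_mx 1%:M (- A) B 1%:M =
   block_mx 1%:M 0 B 1%:M *m block_mx 1%:M (- A) 0 (1%:M + B *m A).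
  by rewrite mulmx_block !(mulmx1, mulmx0, mul0mx, mul1mx, add0r, addr0) mulmxN addrC addrK.
have := congr1 determinant e2; rewrite {1}e1 !det_mulmx !(det_ublock, det_lblock).
by rewrite !det1 !mul1r !mulr1.
Qed.

Section TraceOn.
Variable k : nat.
Implicit Types U C I G : 'M[algC]_k.

(** This frees [tr_on] from [row_base] and the pseudo-inverse: a change of basis of U conjugates
    D. *)
Lemma tr_on_basis r U G (Q : 'M_(r, k)) (D : 'M_r) :
  row_free Q -> (Q :=: U)%MS -> Q *m G = D *m Q -> tr_on U G = \tr D.
Proof.
move=> fQ QU QG; rewrite /tr_on.
have [P rP] : exists P, row_base U = P *m Q.
  by apply/submxP; rewrite eq_row_base QU.
have [P' qP] : exists P', Q = P' *m row_base U.
  by apply/submxP; rewrite eq_row_base QU.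
have PP' : P' *m P = 1%:M by apply: (row_free_inj fQ); rewrite mul1mx -mulmxA -rP -qP.
have P'P : P *m P' = 1%:M.
  by apply: (row_free_inj (row_base_free U)); rewrite mul1mx -mulmxA -qP -rP.
have -> : row_base U *m G = (P *m D *m P') *m row_base U.
  by rewrite {1}rP -mulmxA QG {1}qP !mulmxA.
rewrite -mulmxA mulmxVp ?row_base_free // mulmx1.
by rewrite mxtrace_mulC mulmxA PP' mul1mx.
Qed.

Lemma stablemx_base U G : (U *m G <= U)%MS ->
  exists D : 'M_(\rank U), row_base U *m G = D *m row_base U.
Proof.
by move=> UG; apply/submxP; rewrite eq_row_base (submx_trans _ UG) // submxMr ?eq_row_base.
Qed.

Lemma eq_tr_on U U' G G' : (U :=: U')%MS -> (U *m G <= U)%MS ->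
  U *m G = U *m G' -> tr_on U G = tr_on U' G'.
Proof.
move=> UU' UG eG; have [D rD] := stablemx_base UG.
have eG' : row_base U *m G' = row_base U *m G.
  have /submxP[P ->] : (row_base U <= U)%MS by rewrite eq_row_base.
  by rewrite -!mulmxA eG.
rewrite (tr_on_basis (row_base_free U) (eq_row_base U) rD).
rewrite (@tr_on_basis _ U' G' (row_base U) D) ?row_base_free ?eG' //.
exact: eqmx_trans (eq_row_base U) UU'.
Qed.

(** F carries a basis of [U1] to a basis of [U2], in which [G2] has the matrix that [G1] has in the
    first. *)
Lemma tr_on_iso U1 U2 G1 G2 (F F' : 'M_k) : (U1 *m G1 <= U1)%MS ->
  (U1 *m F :=: U2)%MS -> U1 *m F *m F' = U1 -> U1 *m F *m G2 = U1 *m G1 *m F ->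
  tr_on U1 G1 = tr_on U2 G2.
Proof.
move=> U1G UF FF' FG; have [D rD] := stablemx_base U1G.
have [P rP] : exists P, row_base U1 = P *m U1 by apply/submxP; rewrite eq_row_base.
rewrite (tr_on_basis (row_base_free U1) (eq_row_base U1) rD).
have rFF : row_base U1 *m F *m F' = row_base U1 by rewrite rP -!mulmxA [U1 *m _]mulmxA FF'.
rewrite (@tr_on_basis _ U2 G2 (row_base U1 *m F) D) //.
- apply/row_freeP; exists (F' *m pinvmx (row_base U1)).
  by rewrite mulmxA rFF mulmxVp ?row_base_free.
- by apply: eqmx_trans UF; apply: eqmxMr; apply: eq_row_base.
by rewrite (mulmxA D) -rD rP -!mulmxA; congr (P *m _); rewrite !mulmxA.
Qed.

Lemma tr_on_add U C G (D : 'M_(\rank C)) : (U :&: C = 0)%MS -> (U *m G <= U)%MS ->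
  (row_base C *m G - D *m row_base C <= U)%MS ->
  tr_on (U + C)%MS G = tr_on U G + \tr D.
Proof.
move=> UC0 UG CG; have [DU rU] := stablemx_base UG.
rewrite (tr_on_basis (row_base_free U) (eq_row_base U) rU).
have [E rE] : exists E, row_base C *m G - D *m row_base C = E *m row_base U.
  by apply/submxP; rewrite eq_row_base.
rewrite (@tr_on_basis _ _ _ (col_mx (row_base U) (row_base C)) (block_mx DU 0 E D)).
- by rewrite mxtrace_block.
- rewrite -row_leq_rank -addsmxE (adds_eqmx (eq_row_base U) (eq_row_base C)).
  by rewrite mxrank_disjoint_sum.
- by apply: eqmx_trans (eqmx_sym (addsmxE _ _)) _; apply: adds_eqmx; apply: eq_row_base.
rewrite mul_col_mx mul_block_col mul0mx addr0 rU; congr col_mx.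
by rewrite -rE subrK.
Qed.

(** The quotients (U + I)/I and U/(U :&: I) are isomorphic: a complement C of U :&: I in U
    represents both, with the same matrix D. *)
Lemma tr_on_quotient U I G : (U *m G <= U)%MS -> (I *m G <= I)%MS ->
  tr_on (U + I)%MS G - tr_on I G = tr_on U G - tr_on (U :&: I)%MS G.
Proof.
move=> UG IG; pose N := (U :&: I)%MS; pose C := (U :\: I)%MS.
have NG : (N *m G <= N)%MS by apply: submx_trans (capmxMr _ _ _) (capmxS UG IG).
have NCU : (N + C :=: U)%MS by rewrite addsmxC; apply: addsmx_diff_cap_eq.
have /sub_addsmxP[[E D] CG] : (row_base C *m G <= N + row_base C)%MS.
  rewrite (adds_eqmx (eqmx_refl N) (eq_row_base C)) NCU (submx_trans _ UG) //.
  by rewrite submxMr // eq_row_base diffmxSl.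
have CGN : (row_base C *m G - D *m row_base C <= N)%MS by rewrite CG addrK submxMl.
have CI0 : (I :&: C = 0)%MS by rewrite capmxC; apply: capmx_diff.
have NC0 : (N :&: C = 0)%MS by apply/eqP; rewrite -submx0 -CI0 capmxS ?capmxSr.
have ICU : (I + C :=: U + I)%MS.
  apply/eqmxP/andP; split.
    by rewrite addsmx_sub addsmxSr (submx_trans (diffmxSl _ _)) // addsmxSl.
  by rewrite addsmx_sub addsmxSl andbT -NCU addsmxS // capmxSr.
have -> : tr_on U G = tr_on N G + \tr D.
  by rewrite -(tr_on_add NC0 NG CGN); apply: eq_tr_on => //; apply: eqmx_sym.
have -> : tr_on (U + I)%MS G = tr_on I G + \tr D.
  rewrite -(tr_on_add CI0 IG (submx_trans CGN (capmxSr _ _))).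
  by apply: eq_tr_on; rewrite ?addsmxMr ?addsmxS //; apply: eqmx_sym.
by rewrite ![_ + \tr D]addrC !addrK.
Qed.

End TraceOn.

(** * Word length *)

Section Length.
Variables (gT : finGroupType) (A : {set gT}).
Implicit Types (x y w : gT) (k : nat).

Lemma powgS k : powg A k.+1 = (powg A k * A)%g. Proof. by []. Qed.

Lemma powgD k l : powg A (k + l) = (powg A k * powg A l)%g.
Proof.
elim: l => [|l IHl]; first by rewrite addn0 mulg1.
by rewrite addnS !powgS IHl mulgA.
Qed.

Lemma powg1 : powg A 1 = A. Proof. exact: mul1g. Qed.

Lemma powg_gen k : powg A k \subset <<A>>%g.
Proof.
elim: k => [|k IHk]; first by rewrite sub1set group1.
by rewrite powgS mul_subG // subset_gen.
Qed.

Lemma gen_powg w : w \in <<A>>%g -> exists k, w \in powg A k.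
Proof.
case/gen_prodgP=> k [c Ac ->]; exists k.
elim: k c Ac => [|k IHk] c Ac; first by rewrite big_ord0 set11.
by rewrite big_ord_recr powgS mem_mulg ?IHk.
Qed.

(** The prefixes of a shortest word have minimal lengths 0, ..., k, so they are distinct. Hence the
    bounded search in [len] succeeds on the generated group. *)
Lemma powg_short k w : w \in powg A k -> (forall i, (i < k)%N -> w \notin powg A i) ->
  (k < #|gT|)%N.
Proof.
pose minl x i := (x \in powg A i) && all (fun j => x \notin powg A j) (iota 0 i).
move=> wk wmin.
suff [t [ut st _]] : exists t, [/\ uniq t, size t = k.+1 &
    all (fun x => has (minl x) (iota 0 k.+1)) t].
  by rewrite -st -(card_uniqP ut) max_card.
elim: k w wk wmin => [|k IHk] w wk wmin.
  by exists [:: w]; split=> //=; rewrite /minl wk.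
have [x a xk aA Dw] := mulsgP wk.
have [i ik|t [ut st at_]] := IHk x xk.
  apply/negP => xi; have /negP[] := wmin i.+1 ik.
  by rewrite Dw powgS mem_mulg.
exists (w :: t); split; last 2 first.
- by rewrite /= st.
- apply/allP => y; rewrite inE => /predU1P[-> | /(allP at_) /hasP[i]].
    apply/hasP; exists k.+1; first by rewrite mem_iota add0n ltnSn.
    by rewrite /minl wk; apply/allP => i; rewrite mem_iota => /andP[_]; apply: wmin.
  rewrite mem_iota => /andP[_ ik] yi.
  by apply/hasP; exists i; rewrite // mem_iota /= ltnW.
rewrite cons_uniq ut andbT; apply/negP => /(allP at_) /hasP[i].
rewrite mem_iota add0n => /andP[_ ik] /andP[wi _].
by have := wmin i ik; rewrite wi.
Qed.

Lemma len_le w k : w \in powg A k -> (len A w <= k)%N.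
Proof.
rewrite /len => wk; have [kg|kg] := ltnP k #|gT|.+1.
  rewrite leqNgt; apply/negP => /(before_find 0); rewrite nth_iota // add0n.
  by rewrite wk.
(* Beyond the search range, even the default value of [find] is at most k. *)
by apply: leq_trans kg; rewrite -[X in (_ <= X)%N](size_iota 0) find_size.
Qed.

Lemma len_powg w : w \in <<A>>%g -> w \in powg A (len A w).
Proof.
move=> /gen_powg exk; case: (ex_minnP exk) => k wk kmin.
have kg := powg_short wk; have {}kg : (k < #|gT|)%N.
  by apply: kg => i ik; apply/negP => /kmin; rewrite leqNgt ik.
have : has (fun k => w \in powg A k) (iota 0 #|gT|.+1).
  by apply/hasP; exists k; rewrite // mem_iota leq0n add0n ltnS ltnW.
rewrite /len => h; have := nth_find 0 h; rewrite nth_iota //.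
by move: h; rewrite has_find size_iota.
Qed.

Lemma len_mul x y : x \in <<A>>%g -> y \in <<A>>%g ->
  (len A (x * y)%g <= len A x + len A y)%N.
Proof. by move=> xA yA; rewrite len_le // powgD mem_mulg ?len_powg. Qed.

Lemma len_gen a : a \in A -> (len A a <= 1)%N.
Proof. by move=> aA; rewrite len_le // powg1. Qed.

Lemma gen_ind (P : gT -> Prop) : P 1%g ->
  (forall a w, a \in A -> w \in <<A>>%g -> P w -> P (a * w)%g) ->
  forall w, w \in <<A>>%g -> P w.
Proof.
move=> P1 PS w /gen_powg[k]; elim: k w => [|k IHk] w; first by move/set1P->.
rewrite -add1n powgD powg1 => /mulsgP[a x aA xk ->]; apply: PS => //; last exact: IHk.
exact: (subsetP (powg_gen k)).
Qed.

Hypothesis Ainv : {in A, forall a, a * a = 1}%g.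

Lemma len_pred w : w \in <<A>>%g -> w != 1%g ->
  exists2 a, a \in A & (len A (a * w)%g).+1 = len A w.
Proof.
move=> wA w1; have := len_powg wA; case Dl: (len A w) => [|l].
  by move/set1P => w1'; rewrite w1' eqxx in w1.
rewrite -add1n powgD powg1 => /mulsgP[a x aA xl Dw]; exists a => //.
have Dx : (a * w)%g = x by rewrite Dw mulgA Ainv // mul1g.
apply/eqP; rewrite eqn_leq ltnS Dx len_le //= add1n -Dl Dw.
apply: leq_trans (len_mul (mem_gen aA) _) _; last by rewrite -add1n leq_add2r len_gen.
exact: (subsetP (powg_gen l)).
Qed.

End Length.

(** * Roots and length *)

Definition pos n (v : 'rV[algC]_n) := forall k, 0 <= v 0 k.

Lemma pos_lin n (u v : 'rV[algC]_n) a b : 0 <= a -> 0 <= b -> pos u -> pos v ->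
  pos (a *: u + b *: v).
Proof. by move=> a0 b0 pu pv k; rewrite !mxE addr_ge0 ?mulr_ge0. Qed.

Section Roots.
Variables (gT : finGroupType) (n : nat) (s : 'I_n -> gT) (m : 'I_n -> 'I_n -> nat).
Variable rG : mx_representation algC (Wgrp s) n.
Hypotheses (cox : coxeter_matrix m) (rGs : forall i, rG (s i) = refl_mx m i).
Hypothesis faith : mx_faithful rG.

Notation W := (Wgrp s).
Notation B := (cox_gram m).
Definition al (i : 'I_n) : 'rV[algC]_n := delta_mx 0 i.

Lemma s_W i : s i \in W. Proof. by rewrite mem_gen // imset_f. Qed.
Hint Resolve s_W : core.

Lemma gram_diag i : B i i = 1.
Proof.
have [mii _ _] := cox; rewrite mxE mii root1C raddfN /= opprK.
by rewrite (Creal_ReP 1 _) ?rpred1.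
Qed.

Lemma gram_sym : B^T = B.
Proof. by have [_ msym _] := cox; apply/matrixP => i j; rewrite !mxE msym. Qed.

Lemma al_gram i j : (al i *m B) 0 j = B i j.
Proof. by rewrite -rowE mxE. Qed.

Lemma al_norm i : al i *m B *m (al i)^T = 1%:M.
Proof.
apply/rowP => j; rewrite ord1 /al trmx_delta -colE mxE al_gram gram_diag.
by rewrite mxE eqxx.
Qed.

Lemma mul_refl v i : v *m rG (s i) = v - (2 * (v *m B) 0 i) *: al i.
Proof.
rewrite rGs; apply/rowP => k; rewrite [LHS]mxE.
under eq_bigr do rewrite mxE mulrBr.
rewrite sumrB (bigD1 k) //= eqxx mulr1 big1 ?addr0; last first.
  by move=> j /negPf->; rewrite mulr0.
rewrite !mxE eqxx /= mulr_sumr mulr_suml; congr (_ - _).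
by apply: eq_bigr => j _; rewrite !mxE; ring.
Qed.

Lemma al_refl i : al i *m rG (s i) = - al i.
Proof.
by rewrite mul_refl al_gram gram_diag mulr1 scaler_nat mulr2n opprD addNKr.
Qed.

Lemma al_reflN i j : al i *m rG (s j) = al i - (2 * B i j) *: al j.
Proof. by rewrite mul_refl al_gram. Qed.

Lemma rGM x y : x \in W -> y \in W -> rG (x * y)%g = rG x *m rG y.
Proof. exact: repr_mxM. Qed.

Lemma rG_inj : {in W &, injective rG}. Proof. exact: mx_faithful_inj. Qed.

Lemma s_inv i : (s i * s i)%g = 1%g.
Proof.
apply: rG_inj; rewrite ?groupM ?group1 // rGM // repr_mx1.
apply/row_matrixP => j; rewrite !rowE mulmxA -/(al j) mulmx1 al_reflN.
by rewrite mulmxBl -scalemxAl al_refl al_reflN scalerN opprK subrK.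
Qed.

Lemma sV i : (s i)^-1%g = s i.
Proof. by apply/eqP; rewrite eq_invg_mul s_inv. Qed.

Lemma Sset_inv (A : {set gT}) : A \subset Sset s -> {in A, forall a, a * a = 1}%g.
Proof. by move=> /subsetP sA a /sA /imsetP[i _ ->]; apply: s_inv. Qed.

Lemma gen_sub (A : {set gT}) : A \subset Sset s -> <<A>>%g \subset W.
Proof. exact: genS. Qed.

Lemma refl_rank1 i : rG (s i) = 1%:M - 2 *: (B *m ((al i)^T *m al i)).
Proof.
rewrite rGs; apply/matrixP => j k; rewrite !mxE; congr (_ - _).
rewrite (bigD1 i) //= big1 ?addr0 => [|l lNi]; rewrite !mxE big_ord1 !mxE eqxx /=.
  by rewrite mul1r mulrA.
by rewrite (negPf lNi) mul0r mulr0.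
Qed.

Lemma rG_gram w : w \in W -> rG w *m B *m (rG w)^T = B.
Proof.
move: w; apply: gen_ind; first by rewrite repr_mx1 trmx1 mulmx1 mul1mx.
move=> _ w /imsetP[i _ ->] wW IH; rewrite rGM // trmx_mul !mulmxA -(mulmxA _ _ B).
rewrite -(mulmxA _ (_ *m B)) IH; pose P := (al i)^T *m al i.
rewrite refl_rank1 -/P.
have PT : P^T = P by rewrite trmx_mul trmxK.
have PBP : P *m B *m P = P.
  rewrite /P -!mulmxA [al i *m (B *m _)]mulmxA [_ *m (_ *m al i)]mulmxA.
  by rewrite al_norm mul1mx.
move: P PT PBP => P PT PBP.
have -> : (1%:M - 2 *: (B *m P))^T = 1%:M - 2 *: (P *m B).
  by rewrite !raddfB /= linearZ /= trmx1 trmx_mul PT gram_sym.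
rewrite !(mulmxBl, mulmxBr, mul1mx, mulmx1) -!scalemxAl -!scalemxAr !mulmxA.
have -> : B *m P *m B *m P *m B = B *m P *m B by rewrite -(mulmxA B P B) -(mulmxA B) PBP mulmxA.
rewrite scalerA; apply/matrixP => j k; rewrite !mxE.
ring.
Qed.

Lemma form_inv w (u v : 'rV_n) : w \in W ->
  (u *m rG w *m B *m (v *m rG w)^T) = u *m B *m v^T.
Proof. by move=> wW; rewrite trmx_mul !mulmxA -3!(mulmxA u) rG_gram // mulmxA. Qed.

Lemma root_norm i w : w \in W -> (al i *m rG w *m B *m (al i *m rG w)^T) 0 0 = 1.
Proof. by move=> wW; rewrite form_inv // /al trmx_delta -colE mxE al_gram gram_diag. Qed.

Lemma root_neq0 i w : w \in W -> al i *m rG w <> 0.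
Proof.
by move=> wW w0; have /eqP := root_norm i wW; rewrite w0 !mul0mx mxE eq_sym oner_eq0.
Qed.

Lemma det_s i : \det (rG (s i)) = -1.
Proof.
rewrite refl_rank1 mulmxA scalemxAl -mulNmx det_Sylvester det_mx11 mulmxN.
by rewrite -scalemxAr mulmxA al_norm !mxE eqxx /= !mulr1n mulr1 opprD addNKr.
Qed.

Section Dihedral.
Variables (i j : 'I_n) (neq_ij : i != j).
Let z : algC := (m i j).-root (-1).
Let c := 'Re z.
(* sin (k t) / sin t with t = pi / m_ij *)
Definition Useq k : algC := 'Im (z ^+ k) / 'Im z.

Lemma mij_gt1 : (1 < m i j)%N. Proof. by have [_ _] := cox; apply. Qed.
Let imz : 0 < 'Im z := Im_rootN1_gt0 mij_gt1.

Lemma Useq0 : Useq 0 = 0.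
Proof. by rewrite /Useq expr0 (Creal_ImP 1 _) ?rpred1 // mul0r. Qed.
Lemma Useq1 : Useq 1 = 1.
Proof. by rewrite /Useq expr1 divff // gt_eqF. Qed.
Lemma UseqSS k : Useq k.+2 = 2 * c * Useq k.+1 - Useq k.
Proof.
rewrite /Useq mulrA -mulrBl; congr (_ / _).
rewrite -[2 * c]/(2 * c) -ImMl ?rpredM ?Creal_Re ?rpred_nat // -raddfB /=; congr ('Im _).
have zz : z * z^* = 1 by rewrite -normCK norm_rootN1 ?mij_gt1 // expr1n.
have -> : 2 * c = z + z^* by rewrite /c ReE mulrC divfK ?pnatr_eq0.
by rewrite !exprS mulrDl [z^* * (z * _)]mulrA [z^* * z]mulrC zz mul1r addrK.
Qed.

Lemma Bij : B i j = - c. Proof. by rewrite mxE. Qed.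
Lemma Bji : B j i = - c. Proof. by rewrite -gram_sym mxE Bij. Qed.

(** Here z^p = -1, so z^(2p) = 1 and the sequence has period 2p, which gives the last three
    values. *)
Lemma Useq_ge0 : exists2 p, (0 < p)%N &
  [/\ (forall k, (k <= p)%N -> 0 <= Useq k), Useq p.*2 = 0, Useq p.*2.+1 = 1
    & Useq p.*2.-1 = -1].
Proof.
have [p p0 [zp imp]] := rootN1_pow mij_gt1; exists p => //; rewrite -/z in zp imp.
have z2p : z ^+ p.*2 = 1 by rewrite -muln2 exprM zp sqrrN expr1n.
have U0 : Useq p.*2 = 0 by rewrite /Useq z2p (Creal_ImP 1 _) ?rpred1 // mul0r.
have U1 : Useq p.*2.+1 = 1 by rewrite /Useq exprS z2p mulr1 divff // gt_eqF.
split=> // [k /imp ik|]; first by rewrite divr_ge0 // ltW.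
have := UseqSS p.*2.-1; rewrite prednK ?double_gt0 // U0 U1 mulr0 add0r.
by move=> ->; rewrite opprK.
Qed.

(* the alternating word s_j s_i s_j ... with k letters *)
Fixpoint altw k : gT := if k is l.+1 then (altw l * s (if odd l then i else j))%g else 1%g.

Lemma altw_W k : altw k \in W.
Proof. by elim: k => [|k IHk]; rewrite ?group1 ?groupM. Qed.

Lemma al_altw k : al i *m rG (altw k) =
  Useq k.+1 *: al (if odd k then j else i) + Useq k *: al (if odd k then i else j).
Proof.
elim: k => [|k IHk]; first by rewrite /= repr_mx1 mulmx1 Useq1 Useq0 scale1r scale0r addr0.
rewrite /= rGM ?altw_W // mulmxA IHk; case: (odd k) => /=;
  rewrite mulmxDl -!scalemxAl al_refl al_reflN ?Bij ?Bji UseqSS;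
  apply/rowP => l; rewrite !mxE; ring.
Qed.

End Dihedral.

Lemma Useq_sym i j k : Useq i j k = Useq j i k.
Proof. by have [_ msym _] := cox; rewrite /Useq msym. Qed.

Lemma altw_rot i j a b : altw i j (a + b) =
  (altw i j a * (if odd a then altw j i b else altw i j b))%g.
Proof.
elim: b => [|b IHb]; first by rewrite addn0 /=; case: ifP; rewrite mulg1.
by rewrite addnS /= IHb oddD; case: (odd a) => /=; rewrite -mulgA //; case: (odd b).
Qed.

Lemma s_altw i j k : (s i * altw i j k)%g = altw j i k.+1.
Proof. by rewrite -add1n altw_rot /= mul1g. Qed.

(** w^k acts as 1 + kN; taking for k the order of w forces N = 0 in characteristic 0. *)
Lemma unipotent_eq1 (N : 'M[algC]_n) w : w \in W -> rG w = 1%:M + N -> N *m N = 0 -> w = 1%g.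
Proof.
move=> wW wN NN0; apply: rG_inj; rewrite ?group1 // repr_mx1 wN.
have X k : rG (w ^+ k)%g = 1%:M + k%:R *: N.
  elim: k => [|k IHk]; first by rewrite expg0 repr_mx1 scale0r addr0.
  rewrite expgSr rGM ?groupX // IHk wN mulmxDl mul1mx mulmxDr mulmx1 -scalemxAl NN0 scaler0 addr0.
  by rewrite -addrA -natr1 scalerDl scale1r [N + _]addrC.
have := X #[w]%g; rewrite expg_order repr_mx1 => /eqP.
rewrite addrC -subr_eq subrr eq_sym scaler_eq0 pnatr_eq0.
by rewrite eqn0Ngt order_gt0 => /eqP->; apply: addr0.
Qed.

(** The braid relation is extracted from the representation. By the values of [Useq] the word fixes
    [al i] and [al j], and it differs from the identity by an N whose image lies in their span;
    hence N^2 = 0. *)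
Lemma altw_order i j : i != j -> exists2 p, (0 < p)%N &
  altw i j p.*2 = 1%g /\ (forall k, (k <= p)%N -> 0 <= Useq i j k).
Proof.
move=> ij; have [p p0 [Up U0 U1 UN]] := Useq_ge0 ij; exists p => //; split=> //.
have e1 : al i *m rG (altw i j p.*2) = al i.
  by rewrite al_altw // odd_double U0 U1 scale1r scale0r addr0.
have ji : j != i by rewrite eq_sym.
have e2 : al j *m rG (altw i j p.*2) = al j.
  rewrite -[p.*2]prednK ?double_gt0 // -s_altw rGM ?altw_W // mulmxA al_refl mulNmx al_altw //.
  rewrite prednK ?double_gt0 // -!(Useq_sym i j) U0 UN scale0r add0r.
  by rewrite -[odd _]negbK -oddS prednK ?double_gt0 // odd_double /= scaleN1r opprK.
pose N := rG (altw i j p.*2) - 1%:M.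
apply: (@unipotent_eq1 N); rewrite ?altw_W //; first by rewrite addrC subrK.
have sN : (N <= al i + al j)%MS.
  rewrite /N; elim: (p.*2) => [|k IHk]; first by rewrite repr_mx1 subrr sub0mx.
  rewrite /= rGM ?altw_W //; set t := if _ then _ else _.
  have -> : rG (altw i j k) *m rG (s t) - 1%:M = (rG (altw i j k) - 1%:M) + rG (altw i j k) *m (rG (s t) - 1%:M).
    by rewrite mulmxBr mulmx1 [RHS]addrC addrA subrK.
  rewrite addmx_sub // refl_rank1 addrAC subrr add0r -scaleN1r scalerA !mulmxA scalemxAl.
  apply: mulmx_sub; apply: mulmx_sub; rewrite /t; case: ifP => _; [exact: addsmxSl | exact: addsmxSr].
have /sub_addsmxP[[D D'] DN] := sN.
have aN0 : al i *m N = 0 by rewrite mulmxBr mulmx1 e1 subrr.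
have bN0 : al j *m N = 0 by rewrite mulmxBr mulmx1 e2 subrr.
by rewrite {1}DN mulmxDl -!mulmxA aN0 bN0 !mulmx0 addr0.
Qed.

Lemma det_rG w : w \in W -> \det (rG w) = 1 \/ \det (rG w) = -1.
Proof.
move: w; apply: gen_ind; first by rewrite repr_mx1 det1; left.
move=> _ w /imsetP[i _ ->] wW IH; rewrite rGM // det_mulmx det_s mulN1r.
by case: IH => ->; [right | left; rewrite opprK].
Qed.

Section Parabolic.
Variables (A : {set gT}) (sA : A \subset Sset s).

Lemma mem_gen_W w : w \in <<A>>%g -> w \in W.
Proof. exact: subsetP (gen_sub sA) w. Qed.
Let Ainv := Sset_inv sA.

Lemma sgn_det w : w \in <<A>>%g -> sgn A w = \det (rG w).
Proof.
move=> wA; rewrite /sgn.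
have pw : forall l w, w \in powg A l -> \det (rG w) = (-1) ^+ l.
  elim=> [|k IHk] x; first by move/set1P->; rewrite repr_mx1 det1.
  rewrite powgS => /mulsgP[y a yk aA ->].
  have /imsetP[i _ Da] := subsetP sA a aA.
  rewrite rGM ?Da //; first by rewrite det_mulmx det_s IHk // exprSr.
  exact/mem_gen_W/(subsetP (powg_gen A k)).
by rewrite (pw _ _ (len_powg wA)).
Qed.

(** Left multiplication by s_i changes the determinant, and the determinant is the parity of the
    length. *)
Lemma len_neq i w : s i \in A -> w \in <<A>>%g -> len A (s i * w)%g != len A w.
Proof.
move=> iA wA; apply/eqP => e; have := sgn_det (groupM (mem_gen iA) wA).
rewrite /sgn e -/(sgn A w) sgn_det // rGM ?s_W ?(mem_gen_W wA) // det_mulmx det_s mulN1r.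
have N1 : (-1 : algC) <> 1 by move/eqP; rewrite eqNr oner_eq0.
by case: (det_rG (mem_gen_W wA)) => ->; rewrite ?opprK => // /esym.
Qed.

Lemma len_step i w : s i \in A -> w \in <<A>>%g -> (len A w <= (len A (s i * w)%g).+1)%N.
Proof.
move=> iA wA; have -> : w = (s i * (s i * w))%g by rewrite mulgA s_inv mul1g.
rewrite {2}mulgA s_inv mul1g -add1n.
apply: leq_trans (len_mul (mem_gen iA) (groupM (mem_gen iA) wA)) _.
by rewrite leq_add2r len_gen.
Qed.

Lemma altw_powg i j k : s i \in A -> s j \in A ->
  altw i j k \in powg A k /\ (altw i j k)^-1%g \in powg A k.
Proof.
move=> iA jA; elim: k => [|k [IH IH']]; first by rewrite /= invg1 !set11.
rewrite [altw i j k.+1]/=; set t := if _ then _ else _.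
have tA : s t \in A by rewrite /t; case: ifP.
split; first by rewrite powgS mem_mulg.
by rewrite invMg sV -add1n powgD powg1 mem_mulg.
Qed.

(** Induction through rank two: the longest possible alternating word in s_i and s_j is split off
    from w with lengths adding up. The rest w' has ascents at both i and j, so induction applies to
    it, and [al_altw] writes the root with coefficients [Useq], which are nonnegative in the range
    at hand. *)
Theorem ascent_pos w i : w \in <<A>>%g -> s i \in A ->
  (len A w < len A (s i * w)%g)%N -> pos (al i *m rG w).
Proof.
have [l] := ubnP (len A w); elim: l w i => // l IHl w i lwl wA iA asc.
have [->|w1] := eqVneq w 1%g.
  by move=> k; rewrite repr_mx1 mulmx1 mxE ler0n.
have [a aA /esym la] := len_pred Ainv wA w1.
have /imsetP[j _ Da] := subsetP sA a aA; rewrite {}Da in aA la.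
have ij : i != j.
  by apply/eqP => e; move: asc; rewrite e la ltnNge ltnW.
have [p p0 [alt1 Up]] := altw_order ij.
have altA k : altw i j k \in <<A>>%g.
  by apply: (subsetP (powg_gen A k)); case: (altw_powg k iA aA).
(* w starts with the alternating word of k letters and lengths add up; the bound k <= p is where
   [Useq] is known to be nonnegative. *)
pose P k := (k <= p)%N && (len A ((altw i j k)^-1 * w)%g + k == len A w)%N.
have exP : exists k, P k by exists 0%N; rewrite /P /= invg1 mul1g addn0 eqxx.
have boundP k : P k -> (k <= p)%N by case/andP.
case: (ex_maxnP exP boundP) => k /andP[kp /eqP lk] kmax.
set w' := ((altw i j k)^-1 * w)%g in lk.
have w'A : w' \in <<A>>%g by rewrite groupM ?groupV.
have Dw : w = (altw i j k * w')%g by rewrite mulgA mulgV mul1g.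
have k0 : (0 < k)%N.
  have := kmax 1%N; rewrite /P p0 /= mul1g sV la addn1 eqxx => h; exact: h.
(* If k = p, then s_i times the alternating word has p + 1 letters and, by the relation of length
   2p, equals a word of p - 1 letters; so s_i w would not be longer than w. *)
have {}kp : (k < p)%N.
  rewrite ltn_neqAle kp andbT; apply/eqP => Dk; move: asc; rewrite {2}Dw (mulgA (s i)) s_altw.
  have alt1' : altw j i p.*2 = 1%g.
    have := s_altw i j p.*2; rewrite alt1 mulg1 /= odd_double.
    by move/esym/(canRL (mulgK _)); rewrite mulgV.
  pose x := if odd k.+1 then altw i j k.-1 else altw j i k.-1.
  have Dx : altw j i k.+1 = x^-1%g.
    have := altw_rot j i k.+1 k.-1; rewrite addSn -addnS prednK // Dk addnn alt1' -Dk.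
    by move/esym/(canRL (mulgK _)); rewrite mul1g.
  have xk : x^-1%g \in powg A k.-1.
    by rewrite /x; case: ifP => _; [case: (altw_powg k.-1 iA aA)|case: (altw_powg k.-1 aA iA)].
  apply/negP; rewrite -leqNgt Dx; apply: leq_trans (len_mul _ w'A) _.
    exact: subsetP (powg_gen A k.-1) _ xk.
  by rewrite -lk addnC leq_add2l (leq_trans (len_le xk)) // leq_pred.
(* [t] is the letter that would continue the alternating word, [q] is its last letter. A descent of
   w' at [t] contradicts the maximality of k, one at [q] would make w shorter than it is. *)
pose t := if odd k then i else j; pose q := if odd k then j else i.
have tA : s t \in A by rewrite /t; case: ifP.
have qA : s q \in A by rewrite /q; case: ifP.
have ltk : (len A w' < l)%N by lia.
have ascT : (len A w' < len A (s t * w')%g)%N.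
  rewrite ltn_neqAle eq_sym len_neq //= leqNgt; apply/negP => dsc.
  have : P k.+1.
    have -> : P k.+1 = ((len A (s t * w')%g).+1 + k == len A w' + k)%N.
      by rewrite /P kp lk [altw i j k.+1]/= -/t invMg sV -mulgA addnS.
    by rewrite eqn_add2r eqn_leq dsc len_step.
  by move/kmax; rewrite ltnn.
have ascQ : (len A w' < len A (s q * w')%g)%N.
  rewrite ltn_neqAle eq_sym len_neq //= leqNgt; apply/negP => dsc.
  have Dw2 : w = (altw i j k.-1 * (s q * w'))%g.
    rewrite Dw -{1}(prednK k0) /= -mulgA; congr (_ * (s _ * _))%g.
    by rewrite /q -{2}(prednK k0) /=; case: (odd _).
  have : (len A w <= k.-1 + len A (s q * w')%g)%N.
    have h2 : (s q * w')%g \in <<A>>%g := groupM (mem_gen qA) w'A.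
    rewrite {1}Dw2; apply: leq_trans (len_mul (altA _) h2) _.
    by rewrite leq_add2r len_le //; case: (altw_powg k.-1 iA aA).
  lia.
rewrite Dw rGM ?altw_W ?(mem_gen_W w'A) // mulmxA al_altw // -/t -/q mulmxDl -!scalemxAl.
by apply: pos_lin; rewrite ?Up ?(ltnW kp) //; apply: IHl.
Qed.

End Parabolic.
End Roots.

(** * Parabolic subgroups *)

Lemma pos_antisym n (v : 'rV[algC]_n) : pos v -> pos (- v) -> v = 0.
Proof.
move=> pv nv; apply/rowP => k; apply/eqP; rewrite eq_le mxE -oppr_ge0.
by have := nv k; rewrite mxE => ->; apply: pv.
Qed.

Section Parabolics.
Variables (gT : finGroupType) (n : nat) (s : 'I_n -> gT) (m : 'I_n -> 'I_n -> nat).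
Variable rG : mx_representation algC (Wgrp s) n.
Hypotheses (cox : coxeter_matrix m) (rGs : forall i, rG (s i) = refl_mx m i).
Hypothesis faith : mx_faithful rG.

Notation W := (Wgrp s).
Notation B := (cox_gram m).
Let s_inv := s_inv cox rGs faith.
Let form_inv := form_inv cox rGs.
Let root_norm := root_norm cox rGs.
Let root_neq0 := root_neq0 cox rGs.
Let rG_inj := rG_inj faith.
Let mul_refl := mul_refl rGs.
Let al_refl := al_refl cox rGs.
Let sW i : s i \in W. Proof. exact: s_W. Qed.
Hint Resolve sW : core.
Implicit Types (v : 'rV[algC]_n) (A K H : {set gT}) (x y z u w : gT) (i j k : 'I_n).

Lemma rGK v w : w \in W -> v *m rG w *m rG w^-1%g = v.
Proof. by move=> wW; rewrite -mulmxA -rGM ?groupV // mulgV repr_mx1 mulmx1. Qed.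

Lemma rGKV v w : w \in W -> v *m rG w^-1%g *m rG w = v.
Proof. by move=> wW; rewrite -mulmxA -rGM ?groupV // mulVg repr_mx1 mulmx1. Qed.

Lemma al_sum v : v = \sum_k v 0 k *: al k.
Proof. exact: row_sum_delta. Qed.

Lemma al_pos i : pos (al i). Proof. by move=> k; rewrite mxE ler0n. Qed.

Lemma al_alE i j : al i 0 j = (j == i)%:R. Proof. by rewrite mxE eqxx. Qed.

Lemma descent_neg A w i : A \subset Sset s -> w \in <<A>>%g -> s i \in A ->
  (len A (s i * w)%g < len A w)%N -> pos (- (al i *m rG w)).
Proof.
move=> sA wA iA dsc; rewrite -mulNmx -al_refl -mulmxA -rGM ?(mem_gen_W sA wA) //.
apply: (ascent_pos cox rGs faith sA) => //; first by rewrite groupM // mem_gen.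
by rewrite mulgA s_inv mul1g.
Qed.

Lemma ascentP A w i : A \subset Sset s -> w \in <<A>>%g -> s i \in A ->
  (len A w < len A (s i * w)%g)%N <-> pos (al i *m rG w).
Proof.
move=> sA wA iA; split; first exact: (ascent_pos cox rGs faith sA).
move=> pw; rewrite ltn_neqAle eq_sym (len_neq cox rGs sA) //= leqNgt.
apply/negP => /(descent_neg sA wA iA) nw.
by apply: (root_neq0 (mem_gen_W sA wA)); apply: pos_antisym nw.
Qed.

(** Positivity of the roots of K replaces the comparison of lengths in A, so that A enters only
    through w in <<A>>. *)
Lemma XsetP A K w : A \subset Sset s -> K \subset A ->
  w \in Xset A K <-> w \in <<A>>%g /\ (forall i, s i \in K -> pos (al i *m rG w)).
Proof.
move=> sA KA; rewrite inE; split.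
  case/andP=> wA /forall_inP wK; split=> // i iK.
  by apply/(ascentP sA) => //; [apply: (subsetP KA) | apply: wK].
case=> wA wK; rewrite wA; apply/forall_inP => t tK.
have /imsetP[i _ Dt] := subsetP sA t (subsetP KA t tK); rewrite Dt in tK *.
by apply/(ascentP sA) => //; [apply: (subsetP KA) | apply: wK].
Qed.

Lemma root_sign i w : w \in W -> pos (al i *m rG w) \/ pos (- (al i *m rG w)).
Proof.
move=> wW; have iS : s i \in Sset s by apply: imset_f.
have [asc|] := ltnP (len (Sset s) w) (len (Sset s) (s i * w)%g).
  by left; apply: (ascent_pos cox rGs faith (subxx _)).
rewrite leq_eqVlt (negPf (len_neq cox rGs (subxx _) iS wW)) /= => dsc.
by right; apply: (descent_neg (subxx _)).
Qed.

Definition supp K v := forall k, s k \notin K -> v 0 k = 0.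
Definition is_root v := exists i, exists2 w, w \in W & v = al i *m rG w.

Lemma is_rootE i w : w \in W -> is_root (al i *m rG w). Proof. by exists i, w. Qed.
Lemma root_al i : is_root (al i).
Proof. by exists i, 1%g; rewrite ?group1 // repr_mx1 mulmx1. Qed.
Lemma root_mul v w : is_root v -> w \in W -> is_root (v *m rG w).
Proof. by case=> i [x xW ->] wW; exists i, (x * w)%g; rewrite ?groupM // rGM // mulmxA. Qed.
Lemma root_pm v : is_root v -> pos v \/ pos (- v).
Proof. by case=> i [x xW ->]; apply: root_sign. Qed.
Lemma root_nz v : is_root v -> v <> 0.
Proof. by case=> i [x xW ->]; apply: root_neq0. Qed.
Lemma root_form v : is_root v -> (v *m B *m v^T) 0 0 = 1.
Proof. by case=> i [x xW ->]; apply: root_norm. Qed.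

Lemma supp_al K i : s i \in K -> supp K (al i).
Proof.
by move=> iK k; rewrite al_alE; case: eqP => // ->; rewrite iK.
Qed.

Lemma coord_out K v w k : K \subset Sset s -> w \in <<K>>%g -> s k \notin K ->
  (v *m rG w) 0 k = v 0 k.
Proof.
move=> sK wK kK; move: w wK v; apply: gen_ind => [|a w aK wK IH] v.
  by rewrite repr_mx1 mulmx1.
have /imsetP[i _ Da] := subsetP sK a aK; rewrite Da in aK *.
rewrite rGM ?(mem_gen_W sK wK) // mulmxA IH mul_refl !mxE eqxx /=.
by case: eqP => [e|_]; [rewrite e aK in kK | rewrite mulr0 subr0].
Qed.

Lemma supp_mul K v w : K \subset Sset s -> w \in <<K>>%g -> supp K v -> supp K (v *m rG w).
Proof. by move=> sK wK Kv k kK; rewrite (coord_out _ sK wK kK) Kv. Qed.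

Lemma pos_supp K v z : (forall i, s i \in K -> pos (al i *m rG z)) ->
  supp K v -> pos v -> pos (v *m rG z).
Proof.
move=> zK Kv pv k; rewrite [v]al_sum mulmx_suml summxE sumr_ge0 // => i _.
rewrite -scalemxAl mxE; case: (boolP (s i \in K)) => [iK|/Kv->]; last by rewrite mul0r.
by rewrite mulr_ge0 //; apply: zK.
Qed.

Lemma pos_suppV K v z : (forall i, s i \in K -> pos (al i *m rG z)) -> z \in W ->
  supp K v -> is_root v -> pos (v *m rG z) -> pos v.
Proof.
move=> zK zW Kv rv pvz; case: (root_pm rv) => // nv.
have nvz : pos (- (v *m rG z)).
  rewrite -mulNmx; apply: (pos_supp zK) => // k kK; rewrite mxE Kv // oppr0 //.
by case: (root_nz (root_mul rv zW)); apply: pos_antisym.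
Qed.

(** Roots have norm 1, so the factor is a sign. *)
Lemma root_line (u v : 'rV[algC]_n) (a : algC) : is_root u -> is_root v -> pos u -> pos v -> u = a *: v -> u = v.
Proof.
move=> ru rv pu pv Du.
have a2 : a ^+ 2 = 1.
  have := root_form ru; rewrite Du -!scalemxAl linearZ /= -scalemxAr scalerA mxE root_form //.
  by rewrite mulr1.
move/eqP: a2; rewrite sqrf_eq1 => /orP[/eqP a1|/eqP a1]; first by rewrite Du a1 scale1r.
case: (root_nz ru); apply: pos_antisym => //.
by rewrite Du a1 scaleN1r opprK.
Qed.

(** The images under z of the simple roots occurring in v are nonnegative and combine with positive
    coefficients to [al k], so each is a multiple of [al k]. As z is invertible, v is a multiple of
    a single [al i]. *)
Lemma simple_of_simple K z v k : (forall i, s i \in K -> pos (al i *m rG z)) -> z \in W ->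
  supp K v -> is_root v -> v *m rG z = al k -> exists2 i, s i \in K & v = al i.
Proof.
move=> zK zW Kv rv vz.
have pv : pos v by apply: pos_suppV zK zW Kv rv _; rewrite vz; apply: al_pos.
have [i vi] : exists i, v 0 i != 0.
  apply/existsP; rewrite -negb_forall; apply/negP => /forallP v0; case: (root_nz rv).
  by apply/rowP => i; rewrite mxE; apply/eqP/v0.
have iK : s i \in K by apply: contraR vi => /Kv->.
exists i => //.
have az l : l != k -> (al i *m rG z) 0 l = 0.
  move=> lk; have : (v *m rG z) 0 l = 0 by rewrite vz al_alE (negPf lk).
  rewrite [v]al_sum mulmx_suml summxE => /eqP; rewrite psumr_eq0; last first.
    move=> j _; rewrite -scalemxAl mxE; case: (boolP (s j \in K)) => [jK|/Kv->]; last by rewrite mul0r.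
    by rewrite mulr_ge0 //; apply: zK.
  move/allP/(_ i (mem_index_enum _)); rewrite -scalemxAl mxE mulf_eq0 (negPf vi).
  by move/eqP.
have Dz : al i *m rG z = (al i *m rG z) 0 k *: (v *m rG z).
  apply/rowP => l; rewrite vz [RHS]mxE al_alE; case: eqP => [->|/eqP/az->]; first by rewrite mulr1.
  by rewrite mulr0.
apply/esym/(@root_line _ _ ((al i *m rG z) 0 k)) => //; try exact: root_al; first exact: al_pos.
by rewrite -[LHS](rGK _ zW) {1}Dz -scalemxAl rGK.
Qed.

Lemma conj_refl i x v : x \in W ->
  v *m rG (s i ^ x)%g = v - (2 * (v *m B *m (al i *m rG x)^T) 0 0) *: (al i *m rG x).
Proof.
move=> xW; rewrite conjgE !rGM ?groupM ?groupV // !mulmxA mul_refl mulmxBl -scalemxAl.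
rewrite rGKV //; congr (_ - (2 * _) *: _).
by rewrite -[v in RHS](rGKV _ xW) form_inv // /al trmx_delta -colE [RHS]mxE.
Qed.

Lemma conj_s_al i j x : x \in W -> al i *m rG x = al j -> (s i ^ x)%g = s j.
Proof.
move=> xW ij; apply: rG_inj; rewrite ?groupJ //; apply/row_matrixP => k.
by rewrite !rowE conj_refl // ij mul_refl /al trmx_delta -colE [X in 2 * X]mxE.
Qed.

Lemma conj_s_root i x : x \in W -> al i *m rG x *m rG (s i ^ x)%g = - (al i *m rG x).
Proof.
move=> xW; rewrite conj_refl // root_norm // mulr1 scaler_nat mulr2n opprD addNKr //.
Qed.

(** s_j negates this root, which is therefore a multiple of [al j]. *)
Lemma al_conj_s i j x : x \in W -> pos (al i *m rG x) -> (s i ^ x)%g = s j ->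
  al i *m rG x = al j.
Proof.
move=> xW px ij; have := conj_s_root i xW; rewrite ij mul_refl => /eqP.
rewrite subr_eq addrC -subr_eq opprK -mulr2n -scaler_nat -scalerA => /eqP e.
have {e} e : al i *m rG x = (al i *m rG x *m B) 0 j *: al j.
  by apply: (@scalerI _ _ 2); rewrite ?pnatr_eq0 // e.
apply: (@root_line _ _ ((al i *m rG x *m B) 0 j)) => //; [exact: is_rootE | exact: root_al | exact: al_pos].
Qed.

(** W_K leaves coordinates outside K unchanged, while the reflection negates its own root. *)
Lemma conj_supp K i x : K \subset Sset s -> x \in W -> (s i ^ x)%g \in <<K>>%g ->
  supp K (al i *m rG x).
Proof.
move=> sK xW tK k kK; have := coord_out (al i *m rG x) sK tK kK.
by rewrite conj_s_root // mxE => /eqP; rewrite eqNr => /eqP.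
Qed.

(** This is uniqueness of minimal coset representatives: at a descent i of x the root [al i *m rG x]
    is negative and supported on K, and y keeps it negative. *)
Lemma Xset_gen1 K x y : K \subset Sset s -> y \in W -> x \in <<K>>%g ->
  (forall i, s i \in K -> pos (al i *m rG y)) ->
  (forall i, s i \in K -> pos (al i *m rG (x * y)%g)) -> x = 1%g.
Proof.
move=> sK yW xK yp xyp; apply/eqP; case: eqVneq => // x1.
have xW := mem_gen_W sK xK.
have [a aK la] := len_pred (Sset_inv cox rGs faith sK) xK x1.
have /imsetP[i _ Da] := subsetP sK a aK; rewrite {}Da in aK la.
have nx : pos (- (al i *m rG x)) by apply: descent_neg sK xK aK _; rewrite la.
have nxy : pos (- (al i *m rG (x * y)%g)).
  rewrite rGM // mulmxA -mulNmx; apply: (pos_supp yp) => // k kK.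
  by rewrite mxE (supp_mul sK xK (supp_al aK)) // oppr0.
case: (@root_neq0 i (x * y)%g); first exact: groupM.
by apply: pos_antisym nxy; apply: xyp.
Qed.

Lemma Xset_dec A K y : A \subset Sset s -> K \subset A -> y \in <<A>>%g ->
  exists2 x, x \in Xset A K & (y * x^-1)%g \in <<K>>%g.
Proof.
move=> sA KA; have [l] := ubnP (len A y); elim: l y => // l IHl y lyl yA.
case: (boolP (y \in Xset A K)) => [yX|]; first by exists y; rewrite // mulgV group1.
rewrite inE yA negb_forall => /existsP[t]; rewrite negb_imply -leqNgt => /andP[tK].
have tA := subsetP KA t tK; have /imsetP[i _ Dt] := subsetP sA t tA.
rewrite leq_eqVlt {1}Dt (negPf (len_neq cox rGs sA _ yA)) -?Dt //= => lt.
have [||x xX yx] := IHl (t * y)%g; rewrite ?groupM ?(mem_gen tA) //.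
  by rewrite -ltnS (leq_ltn_trans lt).
exists x => //; rewrite -(groupMl _ (mem_gen tK)) mulgA //.
Qed.

(** The sum absorbs s_i on the left, whereas s_i negates [al i]. *)
Lemma avg0 K v : K \subset Sset s -> supp K v -> v *m (\sum_(u in <<K>>%g) rG u) = 0.
Proof.
move=> sK Kv; rewrite [v]al_sum mulmx_suml big1 // => i _; rewrite -scalemxAl.
case: (boolP (s i \in K)) => [iK|/Kv->]; last by rewrite scale0r.
suff -> : al i *m (\sum_(u in <<K>>%g) rG u) = 0 by rewrite scaler0.
set P := \sum_(u in _) _; have e : rG (s i) *m P = P.
  rewrite /P mulmx_sumr [RHS](reindex_inj (mulgI (s i))).
  apply: eq_big => [u|u uK]; first by rewrite groupMl // mem_gen.
  by rewrite rGM // (mem_gen_W sK).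
have : al i *m P = - (al i *m P) by rewrite -{1}e mulmxA al_refl mulNmx.
by move/eqP; rewrite -subr_eq0 opprK -mulr2n -scaler_nat scaler_eq0 pnatr_eq0 => /eqP.
Qed.

Lemma fixed_supp0 K v : K \subset Sset s -> supp K v ->
  (forall u, u \in <<K>>%g -> v *m rG u = v) -> v = 0.
Proof.
move=> sK Kv fv; have := avg0 sK Kv; rewrite mulmx_sumr (eq_bigr (fun=> v)) //.
rewrite sumr_const => /eqP; rewrite -scaler_nat scaler_eq0 pnatr_eq0.
by rewrite eqn0Ngt cardG_gt0 => /eqP.
Qed.

Lemma fixedP K v : K \subset Sset s ->
  (forall u, u \in <<K>>%g -> v *m rG u = v) <-> (forall i, s i \in K -> (v *m B) 0 i = 0).
Proof.
move=> sK; split=> [fv i iK | fv].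
  have /eqP := fv (s i) (mem_gen iK); rewrite mul_refl -subr_eq0 addrAC subrr add0r.
  rewrite oppr_eq0 scaler_eq0 mulf_eq0 pnatr_eq0 /= => /orP[/eqP//|/eqP a0].
  by have := al_alE i i; rewrite a0 mxE eqxx => /eqP; rewrite eq_sym oner_eq0.
apply: gen_ind => [|a w aK wK IH]; first by rewrite repr_mx1 mulmx1.
have /imsetP[i _ Da] := subsetP sK a aK; rewrite Da in aK *.
by rewrite rGM ?(mem_gen_W sK wK) // mulmxA mul_refl fv // mulr0 scale0r subr0.
Qed.

(** A vector in the radical is fixed by W, hence equal to its average, which is zero. *)
Lemma gram_unit : B \in unitmx.
Proof.
rewrite -row_free_unit; apply: inj_row_free => v vB.
apply: (@fixed_supp0 (Sset s)) => // [k|].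
  by rewrite imset_f.
by apply/(fixedP _ (subxx _)) => i _; rewrite vB mxE.
Qed.

End Parabolics.

(** * Fixed spaces, stabilizers and normalizers of parabolic subgroups *)

Section Stabilizers.
Variables (gT : finGroupType) (n : nat) (s : 'I_n -> gT) (m : 'I_n -> 'I_n -> nat).
Variable rG : mx_representation algC (Wgrp s) n.
Hypotheses (cox : coxeter_matrix m) (rGs : forall i, rG (s i) = refl_mx m i).
Hypothesis faith : mx_faithful rG.

Notation W := (Wgrp s).
Notation B := (cox_gram m).
Let form_inv := form_inv cox rGs.
Let mul_refl := mul_refl rGs.
Let al_refl := al_refl cox rGs.
Let sW i : s i \in W. Proof. exact: s_W. Qed.
Hint Resolve sW : core.
Let descent_neg := descent_neg cox rGs faith.
Let XsetP := XsetP cox rGs faith.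
Let root_sign := root_sign cox rGs faith.
Let root_pm := root_pm cox rGs faith.
Let simple_of_simple := simple_of_simple cox rGs faith.
Let conj_s_al := conj_s_al cox rGs faith.
Let Xset_gen1 := Xset_gen1 cox rGs faith.
Let root_nz := root_nz cox rGs.
Let root_line := root_line cox rGs.
Let al_conj_s := al_conj_s cox rGs.
Let conj_supp := conj_supp cox rGs.
Let Xset_dec := Xset_dec cox rGs.
Let avg0 := avg0 cox rGs.
Let gram_unit := gram_unit cox rGs.
Let coord_out := coord_out rGs.
Let supp_mul := supp_mul rGs.
Let fixedP := fixedP rGs.
Let Sset_inv := Sset_inv cox rGs faith.
Implicit Types (v : 'rV[algC]_n) (A K H : {set gT}) (x y z u w : gT) (i j k : 'I_n).

Variables (L : {set gT}) (sL : L \subset Sset s).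
Let mem_W u : u \in <<L>>%g -> u \in W := @mem_gen_W _ _ _ _ sL u.

Definition fixedL v := forall u, u \in <<L>>%g -> v *m rG u = v.

Lemma sub_Fixmx p (M : 'M_(p, n)) :
  (M <= Fixmx rG L)%MS <-> (forall u, u \in <<L>>%g -> M *m rG u = M).
Proof.
split=> [/sub_bigcapmxP fM u uL | fM].
  by have /sub_kermxP/eqP := fM u uL; rewrite mulmxBr mulmx1 subr_eq0 => /eqP.
by apply/sub_bigcapmxP => u uL; apply/sub_kermxP; rewrite mulmxBr mulmx1 fM // subrr.
Qed.

(* The vector pairing to 1 with the simple roots outside L and to 0 with those of L has stabilizer W_L. *)
Lemma Fix_stab w : w \in W -> (forall v, fixedL v -> v *m rG w = v) -> w \in <<L>>%g.
Proof.
pose ind : 'rV[algC]_n := \row_k (s k \notin L)%:R; pose v0 := ind *m invmx B.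
have v0B : v0 *m B = ind by rewrite mulmxKV // (gram_unit cox rGs).
have fv0 : fixedL v0.
  by apply/(fixedP _ sL) => i iL; rewrite v0B mxE iL.
move=> wW /(_ _ fv0); have [l] := ubnP (len (Sset s) w); elim: l w wW => // l IHl w wW lwl v0w.
have [->|w1] := eqVneq w 1%g; first exact: group1.
have [a aS la] := len_pred (Sset_inv (subxx _)) wW w1.
have /imsetP[i _ Da] := aS; rewrite {}Da in aS la.
have [iL|iL] := boolP (s i \in L).
  rewrite -(groupMl _ (mem_gen iL)); apply: IHl; rewrite ?groupM //; first by rewrite -ltnS la.
  by rewrite rGM // mulmxA fv0 ?mem_gen.
have nw : pos (- (al i *m rG w)).
  by apply: (descent_neg (subxx _)) => //; rewrite la.
(* The positive vector - [al i *m rG w] pairs nonnegatively with [v0]; by invariance of the form and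
   [v0w] this pairing is that of [v0] with - [al i], which is -1. *)
have : 0 <= - (v0 *m B *m (al i)^T) 0 0.
  rewrite -(form_inv v0 (al i) wW) v0w v0B mxE -sumrN sumr_ge0 // => k _.
  rewrite !mxE -mulrN; case: (s k \notin L); rewrite ?mul0r // mul1r.
  by have := nw k; rewrite !mxE.
rewrite v0B /al trmx_delta -colE !mxE iL oppr_ge0 ler10 //.
Qed.

(** Along a word for u the root can turn negative only at some s_j, and just before that it equals
    [al j], because s_j alters the coordinate j alone. *)
Lemma pos_root_conj u v : u \in <<L>>%g -> is_root rG v -> pos v -> supp s L v ->
  pos (v *m rG u) \/ exists j, s j \in L /\ exists2 u', u' \in <<L>>%g & v *m rG u' = al j.
Proof.
move=> uL; move: u uL v; apply: gen_ind => [|a w aL wL IH] v rv pv Lv.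
  by rewrite repr_mx1 mulmx1; left.
have /imsetP[j _ Da] := subsetP sL a aL; rewrite {}Da in aL *.
have rv' : is_root rG (v *m rG (s j)) by apply: root_mul.
rewrite rGM ?(mem_W wL) // mulmxA.
case: (root_pm rv') => [pv'|nv'].
  case: (IH _ rv' pv' (supp_mul sL (mem_gen aL) Lv)) => [|[k [kL [u' u'L e]]]]; first by left.
  by right; exists k; split=> //; exists (s j * u')%g; rewrite ?groupM ?(mem_gen aL) // rGM ?(mem_W u'L) // mulmxA.
right; exists j; split=> //; exists 1%g; rewrite ?group1 // repr_mx1 mulmx1.
apply: (@root_line _ _ (v 0 j)) => //; [exact: root_al | exact: al_pos |].
apply/rowP => k; rewrite !mxE eqxx /=; case: (eqVneq k j) => [->|kj]; first by rewrite mulr1.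
rewrite mulr0; apply/eqP; rewrite eq_le pv andbT.
by have := nv' k; rewrite mul_refl !mxE (negPf kj) mulr0 subr0 oppr_ge0.
Qed.

(** If all images of v under W_L were positive, their sum, which vanishes by [avg0], would force v =
    0. *)
Lemma root_conj_simple v : is_root rG v -> pos v -> supp s L v ->
  exists j, s j \in L /\ exists2 u, u \in <<L>>%g & v *m rG u = al j.
Proof.
move=> rv pv Lv; case: (boolP [forall u in <<L>>%g, forall k, 0 <= (v *m rG u) 0 k]).
  move=> /forall_inP pu; case: (root_nz rv); apply/rowP => k.
  have : (v *m \sum_(u in <<L>>%g) rG u) 0 k = 0 by rewrite (avg0 sL Lv) mxE.
  rewrite mulmx_sumr summxE => /eqP; rewrite psumr_eq0; last by move=> u /pu/forallP.
  move/allP/(_ 1%g (mem_index_enum _)); rewrite group1 /= repr_mx1 mulmx1 mxE => /eqP//.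
rewrite negb_forall => /existsP[u]; rewrite negb_imply => /andP[uL nu].
case: (pos_root_conj uL rv pv Lv) => // pu; case/negP: nu; exact/forallP.
Qed.

Lemma refls_gen : refls L \subset <<L>>%g.
Proof. by apply/subsetP => _ /imset2P[t w tL wL ->]; rewrite groupJ // mem_gen. Qed.

Lemma reflsS : refls L \subset refls (Sset s).
Proof.
apply/subsetP => _ /imset2P[t w tL wL ->]; apply: imset2_f; first exact: (subsetP sL).
exact: mem_W.
Qed.

(** The positive root of t is supported on L, hence conjugate under W_L to a simple root of L. *)
Lemma refls_parabolic t : t \in refls (Sset s) -> t \in <<L>>%g -> t \in refls L.
Proof.
case/imset2P=> _ w /imsetP[i _ ->] wW Dt tL.
wlog pw : w wW Dt / pos (al i *m rG w).
  move=> th; case: (root_sign i wW); first exact: th.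
  move=> nw; apply: (th (s i * w)%g); first exact: groupM.
    by rewrite conjgM (conjgE (s i) (s i)) mulKg.
  by rewrite rGM // mulmxA al_refl mulNmx.
rewrite Dt in tL.
have [j [jL [u uL e]]] := root_conj_simple (is_rootE rG i wW) pw (conj_supp sL wW tL).
have uW := mem_W uL.
have : (s i ^ (w * u))%g = s j by apply: (conj_s_al); rewrite ?groupM // rGM // mulmxA.
rewrite conjgM -Dt => /(canRL (conjgK _)) ->.
by apply: imset2_f; rewrite ?groupV.
Qed.

Notation N := (Nset (Sset s) L).

Lemma NsetP x : x \in N -> [/\ x \in W, (L :^ x)%g = L & forall i, s i \in L -> pos (al i *m rG x)].
Proof.
by rewrite inE => /andP[/(XsetP _ (subxx _) sL)[xW px] /eqP].
Qed.

Lemma NsetI x : x \in W -> (L :^ x)%g = L -> (forall i, s i \in L -> pos (al i *m rG x)) -> x \in N.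
Proof.
by move=> xW Lx px; rewrite inE Lx eqxx andbT; apply/(XsetP _ (subxx _) sL).
Qed.

Lemma Nset_al x i : x \in N -> s i \in L -> exists2 j, s j \in L & al i *m rG x = al j.
Proof.
case/NsetP=> xW Lx px iL; have : (s i ^ x)%g \in L by rewrite -Lx memJ_conjg.
move=> tL; have /imsetP[j _ Dj] := subsetP sL _ tL; exists j; first by rewrite -Dj.
exact: (al_conj_s xW (px i iL)).
Qed.

Lemma Nset_group : group_set N.
Proof.
apply/group_setP; split=> [|x y xN yN].
  by apply: NsetI; rewrite ?group1 ?conjsg1 // => i _; rewrite repr_mx1 mulmx1; apply: al_pos.
have [xW Lx px] := NsetP xN; have [yW Ly py] := NsetP yN.
apply: NsetI; rewrite ?groupM // ?conjsgM ?Lx // => i iL.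
by rewrite rGM // mulmxA; have [j jL ->] := Nset_al xN iL; apply: py.
Qed.
Canonical Ngroup := Group Nset_group.

Lemma Nset_TI : (<<L>> :&: N)%g = 1%g.
Proof.
apply/trivgP/subsetP => x /setIP[xL /NsetP[xW _ px]]; apply/set1P.
apply: (Xset_gen1 sL (group1 _) xL) => i iL; last by rewrite mulg1; apply: px.
by rewrite repr_mx1 mulmx1; apply: al_pos.
Qed.

(** The minimal representative x of the coset of y normalizes W_L too. For s_k in L the root
    [al k *m rG x^-1] is supported on L and sent by x to a simple root, so it is itself simple; thus
    conjugation by x permutes L. *)
Lemma norm_dec y : y \in ('N_W(<<L>>))%g -> exists2 x, x \in N & (y * x^-1)%g \in <<L>>%g.
Proof.
case/setIP=> yW yN; have [x xX ux] := Xset_dec (subxx _) sL yW.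
exists x => //; have [xW px] := (XsetP _ (subxx _) sL).1 xX.
have xN : x \in ('N(<<L>>))%g.
  have -> : x = ((y * x^-1)^-1 * y)%g by rewrite invMg invgK mulgKV.
  by rewrite groupM ?groupV // (subsetP (normG <<L>>%G)).
apply: NsetI => //; apply/esym/eqP; rewrite eqEcard cardJg leqnn andbT.
rewrite -sub_conjgV; apply/subsetP => _ /imsetP[t tL ->].
have /imsetP[k _ Dt] := subsetP sL t tL; rewrite {}Dt in tL *.
have kx : (s k ^ x^-1)%g \in <<L>>%g by rewrite memJ_norm ?groupV // mem_gen.
have [|j jL e] := simple_of_simple px xW (conj_supp sL (groupVr xW) kx)
   (is_rootE rG k (groupVr xW)) (k := k); first by rewrite rGKV.
by rewrite (conj_s_al (groupVr xW) e).
Qed.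

Lemma N_norm : N \subset ('N(<<L>>))%g.
Proof. by apply/subsetP => x /NsetP[xW Lx _]; rewrite inE -genJ Lx. Qed.

Lemma Fix_norm g : g \in ('N_W(<<L>>))%g -> (Fixmx rG L *m rG g :=: Fixmx rG L)%MS.
Proof.
have sub h : h \in ('N_W(<<L>>))%g -> (Fixmx rG L *m rG h <= Fixmx rG L)%MS.
  case/setIP=> hW hN; apply/sub_Fixmx => u uL.
  rewrite -mulmxA; have -> : rG h *m rG u = rG (u ^ h^-1)%g *m rG h.
    by rewrite -!rGM ?groupJ ?groupV ?(mem_W uL) // conjgE invgK -!mulgA mulVg mulg1.
  rewrite mulmxA; congr (_ *m _); move: (u ^ h^-1)%g (memJ_norm u (groupVr hN)) => u' e.
  by have /sub_Fixmx -> := submx_refl (Fixmx rG L); rewrite ?e.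
move=> gN; apply/eqmxP; rewrite sub //=.
have gW : g \in W by case/setIP: gN.
have e : Fixmx rG L = Fixmx rG L *m rG g^-1%g *m rG g.
  by rewrite -mulmxA -rGM ?groupV // mulVg repr_mx1 mulmx1.
by rewrite {1}e submxMr // sub ?groupV.
Qed.

(** The averaging projection onto Fix(W_L); its kernel is the span of the simple roots of L. *)
Let pX := #|<<L>>%g|%:R^-1 *: \sum_(u in <<L>>%g) rG u.

Lemma pX_fixed v : fixedL v -> v *m pX = v.
Proof.
move=> fv; rewrite -scalemxAr mulmx_sumr (eq_bigr (fun=> v)) // sumr_const.
by rewrite -scaler_nat scalerA mulVf ?scale1r // pnatr_eq0 -lt0n cardG_gt0.
Qed.

Lemma pX_Fix : (pX <= Fixmx rG L)%MS.
Proof.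
apply/sub_Fixmx => w wL; rewrite -scalemxAl mulmx_suml; congr (_ *: _).
rewrite [RHS](reindex_inj (mulIg w)); apply: eq_big => [u|u uL]; first by rewrite groupMr.
by rewrite rGM ?mem_W.
Qed.

Lemma pX_supp v : supp s L (v - v *m pX).
Proof.
move=> k kL; have -> : v - v *m pX = #|<<L>>%g|%:R^-1 *: \sum_(u in <<L>>%g) (v - v *m rG u).
  rewrite sumrB scalerBr -mulmx_sumr -scalemxAr sumr_const -scaler_nat scalerA mulVf ?scale1r //.
  by rewrite pnatr_eq0 -lt0n cardG_gt0.
rewrite mxE summxE big1 ?mulr0 // => u uL.
by rewrite mxE [X in _ + X]mxE (coord_out v sL uL kL) subrr.
Qed.

(** The component of v supported on L is fixed by w and orthogonal to Fix(W_L), so cuspidality makes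
    it zero. *)
Lemma cuspidal_fix w v : cuspidal m rG L w -> v *m rG w = v -> fixedL v.
Proof.
case/andP=> wL /eqP/eqP; rewrite mxrank_eq0 => /eqP cap0 vw.
have wW := mem_W wL.
have fp : fixedL (v *m pX) by apply/sub_Fixmx; apply: submx_trans (submxMl _ _) pX_Fix.
suff /eqP : v - v *m pX = 0 by rewrite subr_eq0 => /eqP->.
apply/eqP; rewrite -submx0 -cap0 sub_capmx; apply/andP; split; apply/sub_kermxP.
  by rewrite mulmxBr mulmx1 mulmxBl vw fp // subrr.
have B0 (a : 'rV[algC]_n) r : supp s L a -> (a *m B *m (row r (Fixmx rG L))^T) 0 0 = 0.
  move=> La; have fr : fixedL (row r (Fixmx rG L)) by apply/sub_Fixmx; apply: row_sub.
  have /fixedP-/(_ sL) Br := fr.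
  have -> : a *m B *m (row r (Fixmx rG L))^T = (row r (Fixmx rG L) *m B *m a^T)^T.
    by rewrite !trmx_mul trmxK (gram_sym cox) mulmxA.
  rewrite [LHS]mxE [LHS]mxE big1 // => k _; case: (boolP (s k \in L)) => [/Br->|/La ak]; first by rewrite mul0r.
  by rewrite [_^T _ _]mxE ak mulr0.
apply/rowP => r; rewrite mulmxA [RHS]mxE -(B0 (v - v *m pX) r (pX_supp v)).
by rewrite [LHS]mxE [RHS]mxE; apply: eq_bigr => k _; rewrite !mxE.
Qed.

Hypothesis bulky : N \subset ('C(<<L>>))%g.

Lemma bulky_al x i : x \in N -> s i \in L -> al i *m rG x = al i.
Proof.
move=> xN iL; have [xW _ px] := NsetP xN; apply: al_conj_s => //; first exact: px.
by apply/conjg_fixP/commgP/commute_sym; apply: (centP (subsetP bulky x xN)); apply: mem_gen.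
Qed.

Lemma bulky_supp x v : x \in N -> supp s L v -> v *m rG x = v.
Proof.
move=> xN Lv; rewrite [v]al_sum mulmx_suml; apply: eq_bigr => i _; rewrite -scalemxAl.
by case: (boolP (s i \in L)) => [iL|/Lv->]; rewrite ?scale0r ?bulky_al.
Qed.

Lemma norm_dprod : (<<L>> \x N)%g = ('N_W(<<L>>))%g.
Proof.
rewrite (dprodE (G := <<L>>%G) (H := Ngroup)) ?Nset_TI //; apply/setP => y; apply/mulsgP/idP.
  case=> u x uL xN ->; have [xW _ _] := NsetP xN; rewrite inE groupM ?(mem_W uL) //=.
  exact: groupM (subsetP (normG <<L>>%G) u uL) (subsetP N_norm x xN).
move=> yN; have [x xN yx] := norm_dec yN.
by exists (y * x^-1)%g x; rewrite // mulgKV.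
Qed.

Lemma cent_dprod w : cuspidal m rG L w -> ('C_(<<L>>%g)[w] \x N)%g = ('C_W[w])%g.
Proof.
move=> cw; have wL : w \in <<L>>%g by case/andP: cw.
have wW := mem_W wL.
have cN x : x \in N -> x \in ('C[w])%g.
  by move=> xN; apply/cent1P; apply: (centP (subsetP bulky x xN)).
rewrite (dprodE (G := 'C_(<<L>>)[w]%G) (H := Ngroup)); last 2 first.
- by apply: subset_trans bulky _; rewrite centS // subsetIl.
- by apply/trivgP; rewrite -Nset_TI setSI // subsetIl.
apply/setP => y; apply/mulsgP/idP.
  case=> u x /setIP[uL uw] xN ->; have [xW _ _] := NsetP xN.
  by rewrite inE groupM ?(mem_W uL) //=; apply: groupM uw (cN x xN).
case/setIP=> yW yw; have yN : y \in ('N_W(<<L>>))%g.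
  rewrite inE yW inE; apply/subsetP => _ /imsetP[u uL ->].
  (* For v in Fix(W_L), the vector v y^-1 is fixed by w because y commutes with w; hence it is fixed
     by u, and v is fixed by u^y. *)
  apply: Fix_stab => [|v fv]; first by rewrite groupJ ?(mem_W uL).
  have fy : fixedL (v *m rG y^-1%g).
    apply: (cuspidal_fix cw); rewrite -mulmxA -rGM ?groupV //.
    have -> : (y^-1 * w = w * y^-1)%g by apply/commute_sym/commuteV/commute_sym/cent1P.
    by rewrite rGM ?groupV // mulmxA fv.
  by rewrite conjgE !rGM ?groupM ?groupV ?(mem_W uL) // !mulmxA fy // rGKV.
have [x xN yx] := norm_dec yN; exists (y * x^-1)%g x; rewrite ?mulgKV //.
by rewrite inE yx /=; apply: groupM yw (groupVr (cN x xN)).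
Qed.

(** Let Q be a basis of Fix(W_L) and D the matrix of x on it, so that pX = C Q with Q C = 1. As x
    fixes the simple roots of L, it acts on V as 1 + C (D - 1) Q, whose determinant is det D by
    [det_Sylvester]. *)
Lemma alphaL_mul c x : c \in <<L>>%g -> x \in N -> alphaL rG L (c * x)%g = \det (rG x).
Proof.
move=> cL xN; have [xW Lx px] := NsetP xN; rewrite /alphaL /det_on.
set X := Fixmx rG L; set Q := row_base X; set G := rG x.
have QX : (Q <= X)%MS by rewrite eq_row_base.
have /sub_Fixmx fQX := QX.
have -> : Q *m rG (c * x)%g = Q *m G by rewrite rGM ?(mem_W cL) // mulmxA fQX.
have xNW : x \in ('N_W(<<L>>))%g by rewrite inE xW (subsetP N_norm).
have [D QG] : exists D, Q *m G = D *m Q.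
  by apply/submxP; rewrite (eq_row_base X) -(Fix_norm xNW) submxMr.
have [C pC] : exists C, pX = C *m Q by apply/submxP; rewrite eq_row_base pX_Fix.
have fQ : row_free Q := row_base_free X.
have Qp : Q *m pX = Q.
  by apply/row_matrixP => r; rewrite row_mul pX_fixed // => u uL; rewrite -row_mul fQX.
have QC : Q *m C = 1%:M by apply: (row_free_inj fQ); rewrite mul1mx -mulmxA -pC.
have DG : G = 1%:M + C *m ((D - 1%:M) *m Q).
  rewrite mulmxBl mul1mx -QG mulmxBr mulmxA -pC.
  apply/row_matrixP => r; rewrite !rowE !(mulmxDr, mulmxBr, mulmxN) mulmx1 mulmxA.
  set v := delta_mx _ _; have /(bulky_supp xN) := pX_supp v; rewrite mulmxBl -/G.
  by move/(canRL (subrK _)) => ->; rewrite addrAC addrA.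
rewrite QG -mulmxA mulmxVp // mulmx1 [in RHS]DG det_Sylvester -mulmxA QC mulmx1.
by rewrite addrC subrK.
Qed.

Lemma sgn_alphaL c x : c \in <<L>>%g -> x \in N ->
  sgn (Sset s) (c * x)%g * alphaL rG L (c * x)%g = sgn (Sset s) c.
Proof.
move=> cL xN; have [xW _ _] := NsetP xN; have cW := mem_W cL.
rewrite alphaL_mul // !(sgn_det cox rGs (subxx _)) ?groupM // rGM // det_mulmx -mulrA.
by case: (det_rG cox rGs xW) => ->; rewrite ?mulrNN !mulr1.
Qed.

End Stabilizers.

(** * The Orlik-Solomon algebra *)

Section OrlikSolomon.
Variable gT : finGroupType.
Notation Ed := #|{: {set gT}}|.
Implicit Types (A S D : {set gT}) (t u : gT) (v : 'rV[algC]_Ed).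

(** Operators act on row vectors from the right, so [Lw A] below is exterior multiplication on the
    left by the monomial of A, and [Lt t] multiplication by the generator a_t. *)
Definition evmx (f : {set gT} -> 'rV[algC]_Ed) : 'M[algC]_Ed := \matrix_i f (setv i).
Definition Lw (A : {set gT}) := evmx (monw A).
Definition Lt t := Lw [set t].
Definition Bd := evmx (@bd gT).

Lemma ev_evmx f S : ev S *m evmx f = f S.
Proof. by rewrite /ev -rowE rowK /setv enum_rankK. Qed.

Lemma evmx_ext (M N : 'M[algC]_Ed) : (forall S, ev S *m M = ev S *m N) -> M = N.
Proof.
move=> e; apply/row_matrixP => i; rewrite !rowE.
by have := e (setv i); rewrite /ev /setv enum_valK.
Qed.

Lemma wedgeE A v : wedge (ev A) v = v *m Lw A.
Proof.
rewrite /wedge (bigD1 A) //= [X in _ + X]big1 ?addr0.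
  rewrite mulmx_sum_row [RHS](reindex (@enum_rank {set gT})) /=; last first.
    by exists enum_val => i _; rewrite ?enum_rankK ?enum_valK.
  apply: eq_bigr => S _; rewrite /coef [ev A _ _]mxE !eqxx mul1r rowE -/(ev S).
  by rewrite ev_evmx.
move=> D DA; rewrite big1 // => S _; rewrite /coef mxE eqxx (inj_eq enum_rank_inj).
by rewrite (negPf DA) mul0r scale0r.
Qed.

Definition cnt t S := (\sum_(u in S) ltg u t)%N.

Lemma cntE t S : #|[set u in S | ltg u t]| = cnt t S.
Proof.
rewrite /cnt -sum1dep_card big_mkcondr /=; apply: eq_bigr => u _.
by case: (ltg u t).
Qed.

Lemma cnt_add t u S : u \notin S -> cnt t (u |: S) = (ltg u t + cnt t S)%N.
Proof. by move=> uS; rewrite /cnt big_setU1. Qed.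

Lemma cnt0 t S : (forall u, u \in S -> ltg t u) -> cnt t S = 0%N.
Proof.
move=> tS; rewrite /cnt big1 // => u /tS; rewrite /ltg => tu.
by rewrite ltnNge ltnW.
Qed.

Lemma ltgxx t : ltg t t = false. Proof. exact: ltnn. Qed.

Lemma ltgN t u : t != u -> ltg u t = ~~ ltg t u.
Proof.
move=> tu; rewrite /ltg ltn_neqAle leqNgt andb_idl // => _.
by rewrite (inj_eq val_inj) (inj_eq enum_rank_inj) eq_sym.
Qed.

Lemma sort_enum : sorted (@ltg gT) (enum gT).
Proof.
apply/(sortedP 1%g) => i; rewrite -cardE => ig.
have r j (jg : (j < #|gT|)%N) : enum_rank (nth 1%g (enum gT) j) = j :> nat.
  by rewrite -[j]/(nat_of_ord (Ordinal jg)) -(enum_val_nth 1%g) enum_valK.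
by rewrite /ltg !r // ltnW.
Qed.

Lemma ltg_trans : transitive (@ltg gT).
Proof. by move=> ? ? ?; apply: ltn_trans. Qed.

Lemma enum_min S : S != set0 -> exists t, [/\ t \in S,
  forall u, u \in S -> u != t -> ltg t u & enum S = t :: enum (S :\ t)].
Proof.
have : sorted (@ltg gT) (enum S).
  have -> : enum S = [seq x <- enum gT | x \in S] by rewrite enumT.
  exact: sorted_filter ltg_trans _ _ sort_enum.
have := enum_uniq S; case De: (enum S) => [|t r] /= ur pr S0.
  by move: S0; rewrite -card_gt0 cardE De.
have Dt : enum (S :\ t) = r.
  have -> : enum (S :\ t) = [seq x <- enum S | x != t].
    by rewrite /enum_mem -filter_predI; apply: eq_filter => x; rewrite /= !inE.
  rewrite De /= eqxx; case/andP: ur => tr _; apply/all_filterP/allP => x xr.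
  by apply: contraNneq tr => <-.
exists t; rewrite Dt; split=> //; first by rewrite -mem_enum De mem_head.
move=> u; rewrite -mem_enum De inE => /predU1P[->|ur' _]; first by rewrite eqxx.
exact: (allP (order_path_min ltg_trans pr)).
Qed.

Lemma enum_cons t S : (forall u, u \in S -> ltg t u) -> enum (t |: S) = t :: enum S.
Proof.
move=> tS; have [|x [xS xmin ->]] := @enum_min (t |: S).
  by apply/set0Pn; exists t; rewrite setU11.
have tNS : t \notin S by apply/negP => /tS; rewrite ltgxx.
have <- : t = x.
  apply/eqP; case: eqVneq => // tx.
  have xt := xmin t (setU11 _ _) tx; case/setU1P: xS => [e|/tS tx'].
    by rewrite e eqxx in tx.
  by have := ltg_trans xt tx'; rewrite ltgxx.
by rewrite setU1K.
Qed.

(** Adding a new least element puts its generator in front of the monomial without a sign. *)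
Lemma min_ind (P : {set gT} -> Prop) : P set0 ->
  (forall t S, (forall u, u \in S -> ltg t u) -> P S -> P (t |: S)) -> forall S, P S.
Proof.
move=> P0 PS S; have [k] := ubnP #|S|; elim: k S => // k IHk S Sk.
have [->|S0] := eqVneq S set0; first exact: P0.
have [t [tS tmin _]] := enum_min S0; rewrite -(setD1K tS); apply: PS.
  by move=> u /setD1P[ut uS]; apply: tmin.
by apply: IHk; move: Sk; rewrite (cardsD1 t S) tS.
Qed.

Lemma ev_Lt t S : ev S *m Lt t = if t \in S then 0 else (-1) ^+ cnt t S *: ev (t |: S).
Proof.
rewrite ev_evmx /monw disjoints1; case: (t \in S) => //=.
congr (_ ^+ _ *: _); rewrite -cntE -(card_imset _ (f := pair t)); last by move=> x y [].
apply: eq_card => -[x y]; rewrite !inE /=; apply/idP/imsetP.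
  by case/andP=> /andP[/eqP-> yS] yx; exists y; rewrite // inE yS.
by case=> z; rewrite inE => /andP[zS zt] [-> ->]; rewrite eqxx zS.
Qed.

Lemma scale_sign k l v : (-1) ^+ k *: ((-1) ^+ l *: v) = (-1) ^+ (k + l) *: v.
Proof. by rewrite scalerA exprD. Qed.

Lemma sign_oddN k l v : odd k = ~~ odd l -> (-1) ^+ k *: v = - ((-1) ^+ l *: v).
Proof. by move=> e; rewrite -signr_odd e -scaleNr -[in RHS]signr_odd; case: (odd l); rewrite ?opprK. Qed.

Lemma Lt_anti t u : Lt t *m Lt u = - (Lt u *m Lt t).
Proof.
apply: evmx_ext => S; rewrite mulmxN !mulmxA !ev_Lt.
case tS: (t \in S); case uS: (u \in S);
  rewrite ?mul0mx ?oppr0 // -?scalemxAl ?ev_Lt ?in_setU1 ?tS ?uS ?orbT ?scaler0 ?oppr0 //.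
rewrite !orbF; have [->|tu] := eqVneq t u; first by rewrite !scaler0 oppr0.
rewrite !scale_sign setUCA; apply: sign_oddN; rewrite !cnt_add ?tS ?uS // !oddD (ltgN tu).
by case: (ltg t u); case: (odd (cnt t S)); case: (odd (cnt u S)).
Qed.

(** The boundary is an antiderivation. On a monomial containing t this also recovers the monomial as
    a_t times its boundary. *)
Lemma Lt_Bd t : Lt t *m Bd = 1%:M - Bd *m Lt t.
Proof.
apply: evmx_ext => S; rewrite mulmxBr mulmx1 !mulmxA ev_Lt [ev S *m Bd]ev_evmx /bd mulmx_suml.
case: (boolP (t \in S)) => tS.
  rewrite mul0mx; apply/esym/eqP; rewrite subr_eq0; apply/eqP.
  rewrite (bigD1 t) //= big1 ?addr0 => [|u /andP[uS ut]]; last first.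
    by rewrite -scalemxAl ev_Lt in_setD1 eq_sym ut tS scaler0.
  rewrite -scalemxAl ev_Lt setD11 setD1K // cntE scale_sign.
  rewrite -{2}(setD1K tS) cnt_add ?setD11 // ltgxx add0n -[LHS]scale1r.
  by rewrite -signr_odd oddD addbb.
rewrite -scalemxAl [ev _ *m Bd]ev_evmx /bd (big_setU1 _ tS) /= scalerDr scale_sign.
rewrite setU1K // cntE cnt_add // ltgxx add0n; congr (_ + _).
  by rewrite -[RHS]scale1r -signr_odd oddD addbb.
rewrite scaler_sumr -sumrN; apply: eq_bigr => u uS.
have tu : t != u by apply: contraNneq tS => ->.
rewrite -scalemxAl ev_Lt in_setD1 (negPf tS) andbF !scale_sign !cntE.
have -> : (t |: S) :\ u = t |: (S :\ u).
  by apply/setP => x; rewrite !inE; case: (eqVneq x u) => [->|] //=; rewrite eq_sym (negPf tu).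
have ct : cnt t S = (ltg u t + cnt t (S :\ u))%N by rewrite -{1}(setD1K uS) cnt_add ?setD11.
apply: sign_oddN; rewrite (cnt_add u tS) ct !oddD (ltgN tu).
by case: (ltg t u); case: (odd (cnt t _)); case: (odd (cnt u _)).
Qed.

(** The family [l] is general so that the same rules serve for the a_t and for their conjugates
    a_(t^g). *)
Definition prodL (l : gT -> 'M[algC]_Ed) v (r : seq gT) := foldr (fun t acc => acc *m l t) v r.

(** Moving [l t] to its place in the increasing product costs one sign for each smaller element of
    S, and a repeated factor squares to zero. *)
Lemma prodL_ins (l : gT -> 'M[algC]_Ed) v t S : (forall x y, l x *m l y = - (l y *m l x)) ->
  prodL l v (enum S) *m l t =
    if t \in S then 0 else (-1) ^+ cnt t S *: prodL l v (enum (t |: S)).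
Proof.
move=> anti; have sq x : l x *m l x = 0.
  have /eqP := anti x x; rewrite -subr_eq0 opprK -mulr2n -scaler_nat scaler_eq0 pnatr_eq0.
  by move/eqP.
elim/min_ind: S t => [|t0 S t0S IH] t.
  by rewrite in_set0 enum_cons => [|u]; rewrite ?inE // enum_set0 cnt0 ?scale1r // => u; rewrite inE.
have t0NS : t0 \notin S by apply/negP => /t0S; rewrite ltgxx.
rewrite (enum_cons t0S) /= -mulmxA in_setU1.
have [->|tt0] := eqVneq t t0; first by rewrite sq mulmx0.
case tS: (t \in S).
  by rewrite anti mulmxN mulmxA IH tS mul0mx oppr0.
case lt: (ltg t t0).
  have tall u : u \in t0 |: S -> ltg t u.
    by case/setU1P=> [->//|/t0S]; apply: ltg_trans.
  by rewrite (enum_cons tall) (enum_cons t0S) cnt0 // scale1r /= mulmxA.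
have t0t u : u \in t |: S -> ltg t0 u.
  by case/setU1P=> [->|/t0S//]; rewrite (ltgN tt0) lt.
rewrite anti mulmxN mulmxA IH tS -scalemxAl setUCA (enum_cons t0t) /= cnt_add //.
by rewrite (ltgN tt0) lt add1n exprS mulN1r scaleNr.
Qed.

Lemma prodLE v A : v *m Lw A = prodL Lt v (enum A).
Proof.
elim/min_ind: A v => [|t A tA IH] v.
  rewrite enum_set0 /= -[RHS]mulmx1; congr (_ *m _); apply: evmx_ext => S.
  rewrite ev_evmx mulmx1 /monw disjoint_sym disjoints_subset setC0 subsetT set0U.
  by rewrite (_ : [set _ in _ | _] = set0) ?cards0 ?scale1r //; apply/setP => x; rewrite !inE.
rewrite (enum_cons tA) /= -IH -mulmxA; congr (_ *m _).
have tNA : t \notin A by apply/negP => /tA; rewrite ltgxx.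
have pairsE (C D : {set gT}) : #|[set p in setX C D | ltg p.2 p.1]| = (\sum_(a in C) cnt a D)%N.
  rewrite -sum1dep_card big_mkcondr /= (pair_big_dep (mem C) (fun _ => mem D) (fun a b => (ltg b a : nat))) /=.
  by apply: eq_big => [[a b]|p _] //; rewrite in_setX.
apply: evmx_ext => S; rewrite mulmxA !ev_evmx /monw.
rewrite !disjoints_subset subUset sub1set inE.
case AS: (A \subset ~: S); last by rewrite andbF mul0mx.
rewrite andbT -scalemxAl ev_Lt in_setU (negPf tNA) /=.
case tS: (t \in S); first by rewrite scaler0.
rewrite /= scale_sign setUA !pairsE big_setU1 //=; congr (_ ^+ _ *: _).
rewrite addnC; congr (_ + _)%N; rewrite /cnt.
rewrite [RHS](eq_bigl (fun u => (u \in A) || (u \in S))) => [|u]; last by rewrite !inE.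
rewrite bigU /=; last by rewrite disjoints_subset.
by rewrite -/(cnt t A) (cnt0 tA).
Qed.

Lemma prodL_ev S : prodL Lt (ev set0) (enum S) = ev S.
Proof.
elim/min_ind: S => [|t S tS IH]; first by rewrite enum_set0.
rewrite (enum_cons tS) /= IH ev_Lt (cnt0 tS) scale1r; case: ifP => // /tS.
by rewrite ltgxx.
Qed.

Section Action.
Variable g : gT.
Let lg t := Lt (t ^ g)%g.
Let lg_anti x y : lg x *m lg y = - (lg y *m lg x). Proof. exact: Lt_anti. Qed.

Lemma ev_OSact S : ev S *m OSact g = prodL lg (ev set0) (enum S).
Proof.
rewrite [OSact g]/(evmx (mono_img g)) ev_evmx /mono_img /prodL.
by elim: (enum S) => //= t r ->; rewrite wedgeE.
Qed.

(** Multiplicativity of the action, which is defined on ordered monomials: both sides are sorted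
    with the same sign. *)
Lemma Lt_OSact t : Lt t *m OSact g = OSact g *m lg t.
Proof.
apply: evmx_ext => S; rewrite !mulmxA ev_Lt ev_OSact prodL_ins //.
by case: ifP => _; rewrite ?mul0mx // -scalemxAl ev_OSact.
Qed.

Lemma Lw_OSact v A : v *m Lw A *m OSact g = prodL lg (v *m OSact g) (enum A).
Proof.
rewrite prodLE; elim: (enum A) => //= t r IH.
by rewrite -mulmxA Lt_OSact mulmxA IH.
Qed.

Lemma Bd_OSact : Bd *m OSact g = OSact g *m Bd.
Proof.
have bd0 : ev set0 *m Bd = 0 by rewrite ev_evmx /bd big_set0.
apply: evmx_ext => S; rewrite !mulmxA; elim/min_ind: S => [|t S tS IH].
  by rewrite bd0 mul0mx ev_OSact enum_set0 /= bd0.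
have -> : ev (t |: S) = ev S *m Lt t.
  by rewrite ev_Lt (cnt0 tS) scale1r; case: ifP => // /tS; rewrite ltgxx.
rewrite -!(mulmxA (ev S)) Lt_OSact !mulmxA -[ev S *m Lt t *m Bd]mulmxA Lt_Bd.
rewrite -[_ *m lg t *m Bd]mulmxA Lt_Bd !mulmxBr !mulmx1 mulmxBl !mulmxA -IH.
by rewrite -!(mulmxA (ev S *m Bd)) Lt_OSact.
Qed.

(** Conjugation may destroy the increasing order and sorting again costs a sign; arguments on spans
    only need that it is a scalar. *)
Lemma prodL_conj v A : exists c, prodL lg v (enum A) = c *: (v *m Lw (A :^ g)%g).
Proof.
elim/min_ind: A => [|t A tA [c IH]].
  by exists 1; rewrite enum_set0 conj0g prodLE enum_set0 scale1r.
rewrite (enum_cons tA) /= IH -scalemxAl conjUg conjg_set1 (prodLE v (A :^ g)%g) (prodLE v (_ |: _)) /lg (@prodL_ins Lt v (t ^ g)%g (A :^ g)%g Lt_anti).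
by case: ifP => _; [exists 0; rewrite scale0r scaler0 | eexists; rewrite scalerA].
Qed.

Lemma ev_OSact_conj S : exists c, ev S *m OSact g = c *: ev (S :^ g)%g.
Proof.
by have [c e] := prodL_conj (ev set0) S; exists c; rewrite ev_OSact e prodLE prodL_ev.
Qed.

End Action.

Lemma Lt_Lw t A : exists c, Lt t *m Lw A = c *: (Lw A *m Lt t).
Proof.
suff [c e] : exists c, forall v, v *m Lt t *m Lw A = c *: (v *m Lw A *m Lt t).
  by exists c; apply: evmx_ext => S; rewrite mulmxA e -scalemxAr mulmxA.
elim/min_ind: A => [|u A uA [c IH]].
  have Lw0 v : v *m Lw set0 = v by rewrite prodLE enum_set0.
  by exists 1 => v; rewrite !Lw0 scale1r.
have LwU v : v *m Lw (u |: A) = v *m Lw A *m Lt u by rewrite (prodLE v (u |: A)) (prodLE v A) (enum_cons uA).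
exists (- c) => v; rewrite !LwU IH -scalemxAl.
by rewrite -!mulmxA (Lt_anti t) !mulmxN scaleNr scalerN.
Qed.

Definition proj (T : {set gT}) := evmx (fun S => if S \subset T then ev S else 0).

Lemma monw_proj T A S : monw A S *m proj T =
  if (A \subset T) && (S \subset T) then monw A S else 0.
Proof.
rewrite /monw; case: ifP => _; last by rewrite mul0mx; case: ifP.
by rewrite -scalemxAl ev_evmx subUset; case: ifP; rewrite ?scaler0.
Qed.

Section Ideal.
Variables (G : {group gT}) (n : nat) (rG : mx_representation algC G n).
Implicit Types T : {set gT}.

Lemma sub_hypint p (M : 'M_(p, n)) S :
  (M <= hypint rG S)%MS <-> (forall t, t \in S -> M *m rG t = M).
Proof.
split=> [/sub_bigcapmxP fM u uL | fM].
  by have /sub_kermxP/eqP := fM u uL; rewrite mulmxBr mulmx1 subr_eq0 => /eqP.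
by apply/sub_bigcapmxP => u uL; apply/sub_kermxP; rewrite mulmxBr mulmx1 fM // subrr.
Qed.

Lemma hypintS S D : S \subset D -> (hypint rG D <= hypint rG S)%MS.
Proof.
move=> /subsetP SD; apply/sub_hypint => t /SD tD.
by have /sub_hypint -> := submx_refl (hypint rG D).
Qed.

Lemma hypint_conj S g : S \subset G -> g \in G ->
  (hypint rG (S :^ g)%g :=: hypint rG S *m rG g)%MS.
Proof.
have sub D h : D \subset G -> h \in G -> (hypint rG D *m rG h <= hypint rG (D :^ h)%g)%MS.
  move=> /subsetP DG hG; apply/sub_hypint => _ /imsetP[t tD ->].
  have /sub_hypint e := submx_refl (hypint rG D).
  have tG := DG t tD.
  by rewrite -mulmxA -repr_mxM ?groupJ // -conjgC repr_mxM // mulmxA e.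
move=> SG gG; apply/eqmxP; rewrite sub // andbT.
have SgG : (S :^ g)%g \subset G by rewrite -(conjGid gG) conjSg.
have := sub _ _ SgG (groupVr gG); rewrite conjsgK => /(submxMr (rG g)).
by rewrite -mulmxA -repr_mxM ?groupV // mulVg repr_mx1 mulmx1.
Qed.

Lemma dependent_conj S g : S \subset G -> g \in G ->
  dependent rG (S :^ g)%g = dependent rG S.
Proof.
move=> SG gG; rewrite /dependent cardJg (hypint_conj SG gG).
by rewrite mxrankMfree // row_free_unit repr_mx_unit.
Qed.

Lemma OSideal_gen T A S : A \subset T -> S \subset T -> dependent rG S ->
  (ev S *m Bd *m Lw A <= OSideal rG T)%MS.
Proof.
move=> AT ST dS; apply: (sumsmx_sup A) => //; apply: (sumsmx_sup S); first by rewrite ST.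
by rewrite genmxE wedgeE ev_evmx.
Qed.

Lemma OSideal_sub T p (U : 'M_(p, Ed)) (M : 'M[algC]_Ed) :
  (forall A S, A \subset T -> S \subset T -> dependent rG S ->
     (ev S *m Bd *m Lw A *m M <= U)%MS) -> (OSideal rG T *m M <= U)%MS.
Proof.
move=> gen; rewrite /OSideal sumsmxMr; apply/sumsmx_subP => A AT.
rewrite sumsmxMr; apply/sumsmx_subP => S /andP[ST dS].
by rewrite (eqmxMr M (genmxE _)) wedgeE -[bd S]ev_evmx gen.
Qed.

Lemma OSideal_stable T g : T \subset G -> g \in G -> (T :^ g)%g \subset T ->
  (OSideal rG T *m OSact g <= OSideal rG T)%MS.
Proof.
move=> TG gG Tg; apply: OSideal_sub => A S AT ST dS.
rewrite Lw_OSact; have [c ->] := prodL_conj g (ev S *m Bd *m OSact g) A.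
rewrite scalemx_sub // -(mulmxA (ev S)) Bd_OSact mulmxA.
have [c' ->] := ev_OSact_conj g S; rewrite -!scalemxAl scalemx_sub // OSideal_gen //.
- by apply: subset_trans Tg; rewrite conjSg.
- by apply: subset_trans Tg; rewrite conjSg.
by rewrite dependent_conj // (subset_trans ST).
Qed.

Lemma OSmono_sub T X p (U : 'M_(p, Ed)) (M : 'M[algC]_Ed) :
  (forall S, S \subset T -> (hypint rG S == X)%MS -> (#|S| + \rank X == n)%N ->
     (ev S *m M <= U)%MS) -> (OSmono rG T X *m M <= U)%MS.
Proof.
move=> gen; rewrite /OSmono sumsmxMr; apply/sumsmx_subP => S /and3P[ST SX Sn].
by rewrite (eqmxMr M (genmxE _)) gen.
Qed.

Lemma OSmono_stable T X g : T \subset G -> g \in G -> (T :^ g)%g \subset T ->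
  (X *m rG g :=: X)%MS -> (OSmono rG T X *m OSact g <= OSmono rG T X)%MS.
Proof.
move=> TG gG Tg Xg; apply: OSmono_sub => S ST SX Sn.
have [c ->] := ev_OSact_conj g S; rewrite scalemx_sub //.
apply: (sumsmx_sup (S :^ g)%g); last by rewrite genmxE.
rewrite cardJg Sn andbT (subset_trans _ Tg) ?conjSg //=.
have SgX : (hypint rG (S :^ g)%g :=: X)%MS.
  apply: eqmx_trans (hypint_conj (subset_trans ST TG) gG) _.
  by apply: eqmx_trans Xg; apply: eqmxMr; apply/eqmxP.
exact/eqmxP.
Qed.

(** * Localization of the Orlik-Solomon ideal at X *)

Section Localization.
Variables (T TL : {set gT}) (X : 'M[algC]_n).
Hypotheses (TG : T \subset G) (sTL : TL \subset T).
Hypothesis TLP : forall t, t \in T -> (t \in TL) = (X <= kermx (rG t - 1%:M))%MS.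

Lemma X_hypint S : S \subset T -> (S \subset TL) = (X <= hypint rG S)%MS.
Proof.
move=> /subsetP ST; apply/subsetP/sub_bigcapmxP => h t tS.
  by rewrite -TLP ?ST ?h.
by rewrite TLP ?ST ?h.
Qed.

(** Otherwise, comparing ranks, the hyperplanes of S and of [S :\ t] have the same intersection; it
    contains X, so t fixes X pointwise and lies in [TL]. *)
Lemma dependent_drop S t : S \subset T -> t \in S -> t \notin TL -> S :\ t \subset TL ->
  dependent rG S -> dependent rG (S :\ t).
Proof.
move=> ST tS tTL StL; rewrite /dependent (cardsD1 t S) tS => dS; rewrite ltnNge; apply/negP => ind.
have hS : (hypint rG S <= hypint rG (S :\ t))%MS by apply: hypintS; apply: subsetDl.
have hr : (\rank (hypint rG (S :\ t)) <= \rank (hypint rG S))%N by lia.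
have /eqmxP/eqmx_sym eS : (hypint rG S == hypint rG (S :\ t))%MS by rewrite -(geq_leqif (mxrank_leqif_eq hS)).
have XS : (X <= hypint rG (S :\ t))%MS by rewrite -X_hypint // (subset_trans (subsetDl _ _) ST).
move: XS; rewrite eS -X_hypint // => /subsetP/(_ t tS); exact/negP.
Qed.

(** Only the terms [S :\ t] inside [TL] survive in the boundary of S. If S is not inside [TL], then
    t is its only element outside, [S :\ t] is still dependent, and its monomial is in the ideal,
    being a_u times its own boundary for any u in it. *)
Lemma OSideal_proj : (OSideal rG T *m proj TL <= OSideal rG TL)%MS.
Proof.
apply: OSideal_sub => A S AT ST dS; rewrite ev_evmx /bd !mulmx_suml.
have [AL|AL] := boolP (A \subset TL); last first.
  rewrite big1 ?sub0mx // => t tS.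
  by rewrite -!scalemxAl ev_evmx monw_proj (negPf AL) scaler0.
have [SL|SL] := boolP (S \subset TL).
  rewrite (eq_bigr (fun t => (-1) ^+ #|[set u in S | ltg u t]| *: ev (S :\ t) *m Lw A)).
    by rewrite -mulmx_suml -/(bd S) -[bd S]ev_evmx OSideal_gen.
  by move=> t tS; rewrite -!scalemxAl ev_evmx monw_proj AL (subset_trans (subsetDl _ _) SL).
apply: summx_sub => t tS; rewrite -!scalemxAl scalemx_sub // ev_evmx monw_proj AL /=.
have [StL|_] := boolP (S :\ t \subset TL); last by rewrite sub0mx.
have tTL : t \notin TL.
  by apply: contra SL => tL; rewrite -(setD1K tS) subUset sub1set tL.
have dSt := dependent_drop ST tS tTL StL dS.
have [u uSt] : exists u, u \in S :\ t.
  apply/set0Pn; apply: contraTneq dSt => ->; rewrite /dependent cards0 addn0.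
  by rewrite -leqNgt rank_leq_row.
have -> : monw A (S :\ t) = ev (S :\ t) *m Bd *m Lt u *m Lw A.
  rewrite -[monw _ _]ev_evmx; congr (_ *m _).
  have := congr1 (mulmx (ev (S :\ t))) (Lt_Bd u); rewrite mulmxA ev_Lt uSt mul0mx mulmxBr mulmx1.
  by move/esym/eqP; rewrite subr_eq0 mulmxA => /eqP.
(* The factor a_u is moved past the monomial of A and absorbed into it, which gives a generator of
   the ideal. *)
have [c e] := Lt_Lw u A; rewrite -mulmxA e -scalemxAr scalemx_sub // mulmxA (prodLE _ A).
rewrite (@prodL_ins Lt _ u A (Lt_anti)); case: ifP => _; first by rewrite sub0mx.
rewrite scalemx_sub // -prodLE OSideal_gen //.
by rewrite subUset sub1set AL (subsetP StL).
Qed.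

(** By [tr_on_quotient] both characters are a trace on the same span M minus a trace on its
    intersection with an ideal. The actions of g and h agree on M, and [proj TL], being the identity
    on M, identifies the two intersections. *)
Lemma OSchar_local g h : g \in G -> h \in G -> (T :^ g)%g \subset T ->
  (TL :^ g)%g \subset TL -> (TL :^ h)%g \subset TL ->
  (X *m rG g :=: X)%MS -> (X *m rG h :=: X)%MS ->
  (forall t, t \in TL -> t ^ g = t ^ h)%g ->
  OSchar rG T X g = OSchar rG TL X h.
Proof.
move=> gG hG Tg TLg TLh Xg Xh gh; rewrite /OSchar.
have TLG := subset_trans sTL TG.
have eM : OSmono rG T X = OSmono rG TL X.
  apply: eq_bigl => S; apply/and3P/and3P => -[ST SX Sn]; split=> //.
    by rewrite X_hypint //; case/andP: SX.
  exact: subset_trans sTL.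
rewrite eM; set M := OSmono rG TL X.
have Mg : (M *m OSact g <= M)%MS by apply: OSmono_stable.
have Mh : (M *m OSact h <= M)%MS by apply: OSmono_stable.
rewrite !tr_on_quotient ?OSideal_stable //.
have Mgh : M *m OSact g = M *m OSact h.
  apply/eqP; rewrite -subr_eq0 -mulmxBr -submx0; apply: OSmono_sub => S ST _ _.
  rewrite mulmxBr !ev_OSact (_ : prodL _ _ _ = prodL (fun t => Lt (t ^ h)%g) (ev set0) (enum S)) ?subrr ?sub0mx //.
  have : {subset enum S <= TL} by move=> t; rewrite mem_enum => /(subsetP ST).
  elim: (enum S) => //= t r IH trL; rewrite IH ?gh // ?trL ?mem_head //.
  by move=> u ur; apply: trL; rewrite inE ur orbT.
have Mp : M *m proj TL = M.
  apply/eqP; rewrite -subr_eq0 -{2}[M]mulmx1 -mulmxBr -submx0; apply: OSmono_sub => S ST _ _.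
  by rewrite mulmxBr mulmx1 ev_evmx ST subrr sub0mx.
have sI : (OSideal rG TL <= OSideal rG T)%MS.
  rewrite -[OSideal rG TL]mulmx1; apply: OSideal_sub => A S AT ST dS; rewrite mulmx1.
  by rewrite OSideal_gen // (subset_trans _ sTL).
have eI : (M :&: OSideal rG T :=: M :&: OSideal rG TL)%MS.
  apply/eqmxP; rewrite [(M :&: OSideal rG TL <= _)%MS]capmxS // andbT sub_capmx capmxSl /=.
  have -> : (M :&: OSideal rG T = (M :&: OSideal rG T) *m proj TL)%MS.
    by have /submxP[P ->] := capmxSl M (OSideal rG T); rewrite -mulmxA Mp.
  apply: submx_trans OSideal_proj; apply: submxMr; exact: capmxSr.
congr (_ - _); first exact: eq_tr_on.
apply: eq_tr_on => //; last by have /submxP[P ->] := capmxSl M (OSideal rG T); rewrite -!mulmxA Mgh.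
apply: submx_trans (capmxMr _ _ _) (capmxS Mg _).
exact: OSideal_stable.
Qed.

End Localization.
End Ideal.
End OrlikSolomon.

(** * The descent algebra *)

Section GroupAlgebra.
Variable gT : finGroupType.
Notation Gd := #|gT|.
Implicit Types (x y w : gT) (A K J L : {set gT}).

Definition gmx p (f : gT -> 'rV[algC]_p) : 'M[algC]_(Gd, p) := \matrix_i f (gel i).

Lemma gv_gmx p (f : gT -> 'rV[algC]_p) x : gv x *m gmx f = f x.
Proof. by rewrite /gv -rowE rowK /gel enum_rankK. Qed.

Lemma gmx_ext p (M N : 'M[algC]_(Gd, p)) : (forall x, gv x *m M = gv x *m N) -> M = N.
Proof.
move=> e; apply/row_matrixP => i; rewrite !rowE.
by have := e (gel i); rewrite /gv /gel enum_valK.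
Qed.

Lemma gv_rmul x y : gv x *m rmul y = gv (x * y)%g.
Proof.
rewrite /gv -rowE; apply/rowP => j; rewrite !mxE /gel enum_rankK eqxx /=.
by rewrite -(inj_eq enum_rank_inj) enum_valK eq_sym.
Qed.

Lemma rmulM x y : rmul x *m rmul y = rmul (x * y)%g.
Proof. by apply: gmx_ext => z; rewrite mulmxA !gv_rmul mulgA. Qed.

Lemma rmul1 : rmul (1%g : gT) = 1%:M.
Proof. by apply: gmx_ext => z; rewrite gv_rmul mulg1 mulmx1. Qed.

(** Left multiplication by a in the group algebra. Below, [resmx L] is truncation to the span of
    W_L, and [Rmx L K] is right multiplication by x_K computed in W_L. *)
Definition Lm (a : 'rV[algC]_Gd) := gmx (fun x => a *m rmul x).

Lemma Lm_rmul a w : Lm a *m rmul w = rmul w *m Lm a.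
Proof. by apply: gmx_ext => x; rewrite !mulmxA gv_gmx gv_rmul gv_gmx -mulmxA rmulM. Qed.

Definition resmx L := gmx (fun x => if x \in <<L>>%g then gv x else 0).

Lemma resmx_rmul L w : w \in <<L>>%g -> resmx L *m rmul w = rmul w *m resmx L.
Proof.
move=> wL; apply: gmx_ext => x; rewrite !mulmxA gv_gmx gv_rmul gv_gmx groupMr //.
by case: ifP => _; rewrite ?mul0mx ?gv_rmul.
Qed.

Definition Rmx L K : 'M[algC]_Gd := \sum_(b in Xset L K) rmul b^-1%g.

Lemma xel_Lm L K a : xel L K *m Lm a = a *m Rmx L K.
Proof.
by rewrite mulmx_suml mulmx_sumr; apply: eq_bigr => b _; rewrite gv_gmx.
Qed.

Section Basis.
Variable A : {set gT}.
Hypothesis X1 : forall K, K \subset A -> 1%g \in Xset A K.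

Lemma mKK_neq0 K : K \subset A -> (mKL A K K)%:R != 0 :> algC.
Proof.
move=> KA; rewrite /mKL subxx pnatr_eq0 -lt0n; apply/card_gt0P; exists 1%g.
by apply/setIP; split; rewrite ?[_ \in Xsharp _ _]inE X1 // conjsg1.
Qed.

(** The matrix is triangular for inclusion with nonzero diagonal, so a kernel vector is shown to
    vanish from large subsets downwards. *)
Lemma Mmat_unit : Mmat A \in unitmx.
Proof.
rewrite -row_free_unit; apply: inj_row_free => v vM; apply/rowP => i; rewrite mxE.
have [k] := ubnP (#|gT| - #|setv i|); elim: k i => // k IHk i ik.
have /eqP := congr1 (fun u : 'rV_ _ => u 0 i) vM; rewrite !mxE (bigD1 i) //= big1 ?addr0; last first.
  move=> j ji; rewrite !mxE; have setji : setv j != setv i by rewrite (inj_eq enum_val_inj).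
  case: ifP => _; last by rewrite (negPf ji) mulr0.
  rewrite /mKL; case: ifP => [sij|_]; last by rewrite mulr0.
  rewrite IHk ?mul0r //; apply: leq_trans (_ : _ <= #|gT| - #|setv i|)%N _; last by [].
  apply: ltn_sub2l; first by apply: leq_trans (max_card (mem (setv j))); apply: proper_card; rewrite properEneq eq_sym setji.
  by apply: proper_card; rewrite properEneq eq_sym setji.
rewrite !mxE andbb; case: ifP => [iA|_]; last by rewrite eqxx mulr1 => /eqP.
by rewrite mulf_eq0 (negPf (mKK_neq0 iA)) orbF => /eqP.
Qed.

Lemma xel_eel K : K \subset A ->
  xel A K = \sum_(J : {set gT} | J \subset K) (mKL A K J)%:R *: eel A J.
Proof.
move=> KA; have e : Mmat A *m (invmx (Mmat A) *m Xmat A) = Xmat A by rewrite mulKVmx ?Mmat_unit.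
have := congr1 (row (enum_rank K)) e; rewrite row_mul [in RHS]rowK /setv enum_rankK KA => <-.
rewrite mulmx_sum_row (reindex (@enum_rank {set gT})) /=; last first.
  by exists enum_val => i _; rewrite ?enum_rankK ?enum_valK.
rewrite big_mkcond [RHS]big_mkcond; apply: eq_bigr => J _; rewrite !mxE /setv !enum_rankK KA /=.
rewrite /mKL; case: (boolP (J \subset K)) => [JK|JK].
  by rewrite (subset_trans JK KA).
case: ifP => _; first by rewrite scale0r.
by rewrite (inj_eq enum_rank_inj); case: eqP JK => [->|]; rewrite ?subxx // scale0r.
Qed.

Lemma eel_vanish p (M : 'M_(Gd, p)) K : K \subset A ->
  (forall J, J \subset K -> xel A J *m M = 0) -> eel A K *m M = 0.
Proof.
have [k] := ubnP #|K|; elim: k K => // k IHk K Kk KA vK.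
have := vK K (subxx _); rewrite xel_eel // (bigD1 K) //= mulmxDl mulmx_suml big1 ?addr0.
  by rewrite -scalemxAl => /eqP; rewrite scaler_eq0 (negPf (mKK_neq0 KA)) => /eqP.
move=> J /andP[JK JnK]; have JpK : J \proper K by rewrite properEneq JnK.
rewrite -scalemxAl IHk ?scaler0 ?(subset_trans JK) //.
  exact: leq_trans (proper_card JpK) Kk.
by move=> I IJ; apply: vK; apply: subset_trans JK.
Qed.

(** Modulo the x_J with J proper in K, the multiple m_KK e_K is x_K. *)
Lemma eel_lead p (M : 'M_(Gd, p)) K : K \subset A ->
  (forall J, J \proper K -> xel A J *m M = 0) ->
  (mKL A K K)%:R *: (eel A K *m M) = xel A K *m M.
Proof.
move=> KA vK; rewrite [xel A K]xel_eel // (bigD1 K) //= mulmxDl mulmx_suml -scalemxAl.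
rewrite big1 ?addr0 // => J /andP[JK JnK]; have JpK : J \proper K by rewrite properEneq JnK.
rewrite -scalemxAl eel_vanish ?scaler0 ?(subset_trans JK) // => I IJ.
by apply: vK; apply: sub_proper_trans JpK.
Qed.

End Basis.
End GroupAlgebra.

Section Descent.
Variables (gT : finGroupType) (n : nat) (s : 'I_n -> gT) (m : 'I_n -> 'I_n -> nat).
Variable rG : mx_representation algC (Wgrp s) n.
Hypotheses (cox : coxeter_matrix m) (rGs : forall i, rG (s i) = refl_mx m i).
Hypothesis faith : mx_faithful rG.

Notation W := (Wgrp s).
Let sW i : s i \in W. Proof. exact: s_W. Qed.
Hint Resolve sW : core.
Let XsetP := XsetP cox rGs faith.
Let root_pm := root_pm cox rGs faith.
Let pos_suppV := pos_suppV cox rGs faith.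
Let simple_of_simple := simple_of_simple cox rGs faith.
Let conj_s_al := conj_s_al cox rGs faith.
Let Xset_gen1 := Xset_gen1 cox rGs faith.
Let al_conj_s := al_conj_s cox rGs.
Let Xset_dec := Xset_dec cox rGs.
Let coord_out := coord_out rGs.
Let supp_mul := supp_mul rGs.
Implicit Types (v : 'rV[algC]_n) (A K H : {set gT}) (x y z u w : gT) (i j k : 'I_n).

(** * Mackey decomposition of x_H x_K *)

Section Mackey.
Implicit Types (E F I J : {set gT}) (a b d : gT).
Variables (A L H K : {set gT}).
Hypotheses (sA : A \subset Sset s) (LA : L \subset A) (HL : H \subset L) (KL : K \subset L).
Let sL := subset_trans LA sA.
Let sH := subset_trans HL sL.
Let HA := subset_trans HL LA.
Let KA := subset_trans KL LA.
Let LW u : u \in <<L>>%g -> u \in W := @mem_gen_W _ _ _ _ sL u.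
Let AW u : u \in <<A>>%g -> u \in W := @mem_gen_W _ _ _ _ sA u.
Let HW u : u \in <<H>>%g -> u \in W := @mem_gen_W _ _ _ _ sH u.
Let HinL u : u \in <<H>>%g -> u \in <<L>>%g.
Proof. exact: (subsetP (genS HL)). Qed.
Let LinA u : u \in <<L>>%g -> u \in <<A>>%g.
Proof. exact: (subsetP (genS LA)). Qed.

Definition xpart (E : {set gT}) y := odflt 1%g [pick x in Xset E H | (y * x^-1)%g \in <<H>>%g].

Lemma xpartP E y : E \subset Sset s -> H \subset E -> y \in <<E>>%g ->
  xpart E y \in Xset E H /\ (y * (xpart E y)^-1)%g \in <<H>>%g.
Proof.
move=> sE HE yE; rewrite /xpart; case: pickP => [x /andP[] //|none].
by have [x xX yx] := Xset_dec sE HE yE; have := none x; rewrite /= xX yx.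
Qed.

Lemma xpart_uniq E y x : E \subset Sset s -> H \subset E -> y \in <<E>>%g ->
  x \in Xset E H -> (y * x^-1)%g \in <<H>>%g -> xpart E y = x.
Proof.
move=> sE HE yE xX yx; have [pX yp] := xpartP sE HE yE; set q := xpart E y in pX yp *.
have [qE qp] := (XsetP _ sE HE).1 pX; have [xE xp] := (XsetP _ sE HE).1 xX.
have e : (q * x^-1)%g \in <<H>>%g.
  have -> : (q * x^-1 = (y * q^-1)^-1 * (y * x^-1))%g by rewrite invMg invgK -mulgA mulKg.
  by rewrite groupM ?groupV.
have : (q * x^-1)%g = 1%g.
  apply: (Xset_gen1 sH (mem_gen_W sE xE) e xp) => i iH; rewrite mulgKV; exact: qp.
by move/eqP; rewrite mulg_eq1 invgK => /eqP.
Qed.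

(** For b in [Xset L K], this is the minimal element d of the double coset of b for W_K and W_H, and
    b lies in d W_H; these d form [Dset]. *)
Definition dpart b := (xpart L b^-1)^-1%g.
Definition Dset := [set d in Xset L K | d^-1%g \in Xset L H].
Definition Kd d := K :&: (H :^ d^-1)%g.

Lemma Kd_sub d : Kd d \subset A. Proof. by rewrite subIset ?KA. Qed.

(** The dichotomy behind the bijection: a root supported on H is handled through the simple roots of
    H, and any other has its sign read off from a coordinate that W_H leaves unchanged. *)
Lemma supp_dec v : supp s H v \/ exists2 l, s l \notin H & v 0 l != 0.
Proof.
case: (boolP [forall l, (s l \notin H) ==> (v 0 l == 0)]) => [/forallP h|].
  by left=> l lH; apply/eqP; apply: (implyP (h l)).
by rewrite negb_forall => /existsP[l]; rewrite negb_imply => /andP[lH vl]; right; exists l.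
Qed.

Lemma root_coord_pos v l : is_root rG v -> v 0 l != 0 -> 0 <= v 0 l -> pos v.
Proof.
move=> rv vl v0; case: (root_pm rv) => // /(_ l); rewrite mxE oppr_ge0 => v0'.
by case/eqP: vl; apply/eqP; rewrite eq_le v0 v0'.
Qed.

Lemma Dset_pos d u k : d \in W -> u \in <<H>>%g ->
  (forall i, s i \in H -> pos (al i *m rG d^-1%g)) ->
  pos (al k *m rG (d * u)%g) -> pos (al k *m rG d).
Proof.
move=> dW uH dp pu; have rd := is_rootE rG k dW.
case: (supp_dec (al k *m rG d)) => [sp|[l lH dl]].
  by apply: (pos_suppV dp (groupVr dW) sp rd); rewrite rGK //; apply: al_pos.
apply: (root_coord_pos rd dl); rewrite -(coord_out _ sH uH lH) -mulmxA -rGM ?(HW uH) //.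
Qed.

Lemma Kd_simple d k : d \in W -> (forall i, s i \in H -> pos (al i *m rG d^-1%g)) ->
  supp s H (al k *m rG d) -> exists2 h, s h \in H & al k *m rG d = al h.
Proof.
move=> dW dp sp; apply: (simple_of_simple dp (groupVr dW) sp (is_rootE rG k dW) (k := k)).
by rewrite rGK.
Qed.

Lemma DsetP d : d \in Dset -> [/\ d \in <<L>>%g, d \in W,
  forall i, s i \in K -> pos (al i *m rG d) & forall i, s i \in H -> pos (al i *m rG d^-1%g)].
Proof.
rewrite inE => /andP[/(XsetP _ sL KL)[dL dK] /(XsetP _ sL HL)[_ dH]].
by split=> //; apply: LW.
Qed.

Lemma dpartP b : b \in Xset L K -> dpart b \in Dset /\ ((dpart b)^-1 * b)%g \in <<H>>%g.
Proof.
move/(XsetP _ sL KL) => [bL bK]; have [xX xb] := xpartP sL HL (groupVr bL).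
rewrite /dpart; set x := xpart L b^-1 in xX xb *; rewrite invgK.
have [xL xp] := (XsetP _ sL HL).1 xX.
have uH : (x * b)%g \in <<H>>%g by rewrite -groupV invMg.
split=> //; rewrite inE invgK xX andbT; apply/(XsetP _ sL KL); split=> [|k kK]; first by rewrite groupV.
apply: (@Dset_pos x^-1 (x * b)); rewrite ?groupV ?LW ?invgK // mulKg; exact: bK.
Qed.

Lemma KdP d i : d \in Dset -> s i \in Kd d -> exists2 h, s h \in H & al i *m rG d = al h.
Proof.
case/DsetP=> dL dW dK dH; rewrite !inE => /andP[iK]; rewrite mem_conjg invgK => iH.
have /imsetP[h _ e] := subsetP sH _ iH; exists h; first by rewrite -e.
by apply: al_conj_s => //; apply: dK.
Qed.

(** The bijection sends (b, a) to (d, b a); since d^-1 b lies in W_H, the minimal representative of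
    the coset of d^-1 b a gives back a. *)
Lemma Mackey_pair b a : b \in Xset L K -> a \in Xset A H ->
  (b * a)%g \in Xset A (Kd (dpart b)) /\ xpart A ((dpart b)^-1 * (b * a))%g = a.
Proof.
move=> bX aX; have [dD uH] := dpartP bX; set d := dpart b in dD uH *; set u := (d^-1 * b)%g in uH.
have [dL dW dK dH] := DsetP dD; have [bL bK] := (XsetP _ sL KL).1 bX.
have [aA aH] := (XsetP _ sA HA).1 aX; have bW := LW bL; have aW := AW aA.
split; last first.
  apply: xpart_uniq => //; last by rewrite mulgA mulgK.
  exact: groupM (groupVr (LinA dL)) (groupM (LinA bL) aA).
apply/(XsetP _ sA (Kd_sub _)); split=> [|k kKd]; first by rewrite groupM ?(LinA bL).
have [h hH e] := KdP dD kKd.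
have eb : al k *m rG b = al h *m rG u by rewrite -e -mulmxA -rGM ?(HW uH) // mulKVg.
rewrite rGM // mulmxA eb; apply: (pos_supp aH); first by apply: supp_mul => //; apply: supp_al.
by rewrite -eb; apply: bK; move: kKd; rewrite inE => /andP[].
Qed.

Lemma Mackey_pairV d x : d \in Dset -> x \in Xset A (Kd d) ->
  let a := xpart A (d^-1 * x)%g in
  [/\ a \in Xset A H, (x * a^-1)%g \in Xset L K & dpart (x * a^-1)%g = d].
Proof.
move=> dD xX a; have [dL dW dK dH] := DsetP dD.
have [xA xp] := (XsetP _ sA (Kd_sub d)).1 xX; have xW := AW xA.
have dxA : (d^-1 * x)%g \in <<A>>%g by rewrite groupM ?groupV ?(LinA dL).
have [aX uH] := xpartP sA HA dxA; rewrite -/a in aX uH.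
have [aA aH] := (XsetP _ sA HA).1 aX; have aW := AW aA.
set u := (d^-1 * x * a^-1)%g in uH; have uW := HW uH.
have Db : (x * a^-1)%g = (d * u)%g by rewrite /u -mulgA mulKVg.
have Dx : x = (d * u * a)%g by rewrite -Db mulgKV.
clearbody u.
have bL : (d * u)%g \in <<L>>%g by rewrite groupM ?(HinL uH).
split=> //; rewrite Db.
  apply/(XsetP _ sL KL); split=> // k kK.
  case: (supp_dec (al k *m rG d)) => [sp|[l lH dl]].
    have [h hH e] := Kd_simple dW dH sp.
    have kKd : s k \in Kd d.
      by rewrite inE kK mem_conjg invgK (conj_s_al dW e).
    have := xp k kKd; rewrite Dx !rGM ?groupM // !mulmxA e.
    apply: (pos_suppV aH aW); first by apply: supp_mul => //; apply: supp_al.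
    by apply: root_mul => //; apply: root_al.
  have rdu : is_root rG (al k *m rG (d * u)%g) by apply: is_rootE; rewrite groupM.
  have e : (al k *m rG (d * u)%g) 0 l = (al k *m rG d) 0 l.
    by rewrite rGM // mulmxA (coord_out _ sH uH lH).
  by apply: (root_coord_pos rdu (l := l)); rewrite e //; apply: dK.
apply: invg_inj; rewrite /dpart invgK; apply: xpart_uniq => //; rewrite ?groupV //.
  by move: dD; rewrite inE => /andP[].
by rewrite invgK invMg -mulgA mulVg mulg1 groupV.
Qed.

(** F is arbitrary because the bijection serves twice in [xel_Rmx]: for group elements and for
    counting. *)
Lemma Mackey_reindex (V : nmodType) (F : gT -> gT -> V) :
  \sum_(b in Xset L K) \sum_(a in Xset A H) F (dpart b) (b * a)%g =
  \sum_(d in Dset) \sum_(x in Xset A (Kd d)) F d x.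
Proof.
rewrite pair_big /= [RHS]pair_big_dep /=.
pose h (p : gT * gT) := (dpart p.1, (p.1 * p.2)%g).
pose h' (q : gT * gT) := let a := xpart A (q.1^-1 * q.2)%g in ((q.2 * a^-1)%g, a).
rewrite [RHS](reindex_onto h h'); last first.
  move=> [d x] /andP[/= dD xX]; have [_ _ e] := Mackey_pairV dD xX.
  by rewrite /h /h' /= e mulgKV.
apply: eq_bigl => -[b a] /=; apply/andP/andP.
  case=> bX aX; have [baX e] := Mackey_pair bX aX; have [dD _] := dpartP bX.
  by rewrite dD baX /h' /= e mulgK eqxx.
case=> /andP[dD baX] /eqP[e1 e2]; have [] := Mackey_pairV dD baX.
by rewrite e2 mulgK.
Qed.

Definition Ncard (J I : {set gT}) := #|[set z in Xset L K | (I :^ z)%g == J]|.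

Lemma XsetS (E F : {set gT}) x : E \subset F -> x \in Xset A F -> x \in Xset A E.
Proof.
move=> /subsetP EF; rewrite !inE => /andP[-> /forall_inP h] /=.
by apply/forall_inP => t /EF; apply: h.
Qed.

Lemma mKLE (E I : {set gT}) :
  mKL A E I = (\sum_(x in Xset A E) ((I \subset E) && ((I :^ x)%g \subset A)))%N.
Proof.
rewrite /mKL; case: ifP => IE; last by rewrite big1.
rewrite -sum1_card big_mkcond [RHS]big_mkcond; apply: eq_bigr => x _.
rewrite inE; case: (boolP (x \in Xset A E)) => //= xE.
by rewrite inE (XsetS IE xE) /=; case: (_ \subset A).
Qed.

(** As b = d u with u in W_H, the elements b and d send the same roots into the span of H. There
    [simple_of_simple] makes the images simple, for b because a sends them on to simple roots, for d
    because d^-1 sends them back to simple roots. *)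
Lemma Kd_equiv b a I : I \subset K -> b \in Xset L K -> a \in Xset A H ->
  (I \subset Kd (dpart b)) && ((I :^ (b * a))%g \subset A) =
  ((I :^ b)%g \subset H) && (((I :^ b) :^ a)%g \subset A).
Proof.
move=> IK bX aX; rewrite conjsgM [LHS]andbC [RHS]andbC; apply: andb_id2l => IbaA.
have [dD uH] := dpartP bX; set d := dpart b in dD uH *; set u := (d^-1 * b)%g in uH.
have [dL dW dK dH] := DsetP dD; have [bL bK] := (XsetP _ sL KL).1 bX.
have [aA aH] := (XsetP _ sA HA).1 aX; have bW := LW bL; have aW := AW aA; have uW := HW uH.
have Db : b = (d * u)%g by rewrite mulKVg.
clearbody u.
apply/subsetP/idP => [IKd | IbH].
  apply/subsetP => _ /imsetP[t tI ->]; have tK := subsetP IK t tI.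
  have /imsetP[i _ Dt] := subsetP sA _ (subsetP KA t tK); rewrite {}Dt in tI tK *.
  have [h hH e] := KdP dD (IKd _ tI).
  have eb : al i *m rG b = al h *m rG u by rewrite -e -mulmxA -rGM // -Db.
  have sp : supp s H (al i *m rG b) by rewrite eb; apply: supp_mul => //; apply: supp_al.
  have tba : (s i ^ (b * a))%g \in A by apply: (subsetP IbaA); rewrite -conjsgM memJ_conjg.
  have /imsetP[j _ ej] := subsetP sA _ tba.
  have pba : pos (al i *m rG b *m rG a) by apply: (pos_supp aH) => //; apply: bK.
  have eba : al i *m rG b *m rG a = al j.
    rewrite -mulmxA -rGM //; apply: al_conj_s => //; first exact: groupM.
    by rewrite rGM // mulmxA.
  have [h' h'H e'] := simple_of_simple aH aW sp (is_rootE rG i bW) eba.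
  by rewrite (conj_s_al bW e').
move=> t tI; have tK := subsetP IK t tI.
have /imsetP[i _ Dt] := subsetP sA _ (subsetP KA t tK); rewrite {}Dt in tI tK *.
have tb : (s i ^ b)%g \in H by apply: (subsetP IbH); rewrite memJ_conjg.
have /imsetP[h _ eh] := subsetP sH _ tb.
have eb : al i *m rG b = al h by apply: al_conj_s => //; apply: bK.
have ed : al i *m rG d = al h *m rG u^-1%g.
  by rewrite -eb -mulmxA -rGM ?groupV // Db mulgK.
have [|h' h'H e'] := @Kd_simple d i dW dH.
  by rewrite ed; apply: supp_mul; rewrite ?groupV //; apply: supp_al; rewrite -eh.
by rewrite inE tK mem_conjg invgK (conj_s_al dW e').
Qed.

Lemma X1 (E F : {set gT}) : E \subset Sset s -> F \subset E -> 1%g \in Xset E F.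
Proof.
move=> sE FE; apply/(XsetP _ sE FE); split; first exact: group1.
by move=> i _; rewrite repr_mx1 mulmx1; apply: al_pos.
Qed.

(** The coefficient of e_I counts pairs (b, a); grouping the b by J = I^b splits the count into
    [mKL A H J] and [Ncard]. *)
Lemma xel_Rmx : xel A H *m Rmx L K =
  \sum_(I : {set gT} | I \subset K) (\sum_(J : {set gT} | J \subset H) mKL A H J * Ncard J I)%N%:R *: eel A I.
Proof.
have -> : xel A H *m Rmx L K = \sum_(d in Dset) xel A (Kd d).
  rewrite mulmx_sumr -[RHS](Mackey_reindex (fun d x => gv x^-1%g)).
  apply: eq_bigr => b _; rewrite mulmx_suml; apply: eq_bigr => a _.
  by rewrite gv_rmul invMg.
have X1A (E : {set gT}) : E \subset A -> 1%g \in Xset A E by apply: X1.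
transitivity (\sum_(d in Dset) \sum_(I : {set gT} | I \subset K) (mKL A (Kd d) I)%:R *: eel A I).
  apply: eq_bigr => d _; rewrite xel_eel ?Kd_sub // big_mkcond [RHS]big_mkcond.
  apply: eq_bigr => I _; case: (boolP (I \subset Kd d)) => IKd.
    by rewrite (subset_trans IKd) ?subsetIl.
  by rewrite /mKL (negPf IKd) scale0r if_same.
rewrite exchange_big /=; apply: eq_bigr => I IK; rewrite -scaler_suml -natr_sum; congr (_%:R *: _).
under eq_bigr do rewrite mKLE.
rewrite -(Mackey_reindex (fun d x => ((I \subset Kd d) && ((I :^ x)%g \subset A) : nat))).
transitivity (\sum_(b in Xset L K) mKL A H (I :^ b)%g)%N.
  apply: eq_bigr => b bX; rewrite mKLE; apply: eq_bigr => a aX.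
  by rewrite (Kd_equiv IK bX aX).
rewrite (partition_big (fun b => (I :^ b)%g) xpredT) //= big_mkcond [RHS]big_mkcond /=.
rewrite [LHS]big_mkcond; apply: eq_bigr => J _ /=.
rewrite (eq_bigr (fun=> mKL A H J)) => [|b /andP[_ /eqP->] //].
rewrite sum_nat_const /Ncard mulnC; case: ifP => JH; last by rewrite /mKL JH.
by congr (_ * _)%N; apply: eq_card => z; rewrite inE.
Qed.

End Mackey.

(** Expanding x_H in [xel_Rmx] along the e_J with J inside H, the terms for J proper cancel by
    induction. *)
Lemma eel_Rmx (A L H K : {set gT}) : A \subset Sset s -> L \subset A -> H \subset L -> K \subset L ->
  eel A H *m Rmx L K = \sum_(I : {set gT} | I \subset K) (Ncard L K H I)%:R *: eel A I.
Proof.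
move=> sA LA HL KL; have [k] := ubnP #|H|; elim: k H HL => // k IHk H HL Hk.
have HA := subset_trans HL LA.
have X1A (E : {set gT}) : E \subset A -> 1%g \in Xset A E by apply: X1.
have := xel_Rmx sA LA HL KL; rewrite xel_eel // (bigD1 H) //= mulmxDl mulmx_suml.
rewrite (eq_bigr (fun J => \sum_(I : {set gT} | I \subset K) ((mKL A H J * Ncard L K J I)%N%:R *: eel A I))); last first.
  move=> J /andP[JH JnH]; have JpH : J \proper H by rewrite properEneq JnH.
  rewrite -scalemxAl IHk; first by rewrite scaler_sumr; apply: eq_bigr => I _; rewrite scalerA natrM.
    exact: subset_trans HL.
  exact: leq_trans (proper_card JpH) Hk.
under [RHS]eq_bigr do rewrite (bigD1 H) //= natrD scalerDl natr_sum scaler_suml.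
rewrite big_split /= [X in _ = _ + X]exchange_big /= => /addIr.
rewrite -scalemxAl => e; apply: (@scalerI _ _ (mKL A H H)%:R); first exact: mKK_neq0.
by rewrite e scaler_sumr; apply: eq_bigr => I _; rewrite scalerA natrM.
Qed.

Lemma eel_Rmx0 (A L K : {set gT}) : A \subset Sset s -> L \subset A -> K \proper L ->
  eel A L *m Rmx L K = 0.
Proof.
move=> sA LA KL; rewrite eel_Rmx ?(proper_sub KL) // big1 // => I IK.
rewrite /Ncard (_ : [set z in _ | _] = set0) ?cards0 ?scale0r //.
apply/setP => z; rewrite !inE; apply/negP => /andP[_ /eqP IL].
by have := proper_card (sub_proper_trans IK KL); rewrite -IL cardJg ltnn.
Qed.

(** * Comparison of e_L in W and in W_L *)

Section Localize.
Variables (L : {set gT}) (sL : L \subset Sset s).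
Hypothesis bulky : Nset (Sset s) L \subset ('C(<<L>>))%g.
Notation N := (Nset (Sset s) L).

Lemma xel_res K : K \subset L -> xel (Sset s) K *m resmx L = xel L K.
Proof.
move=> KL; have KS := subset_trans KL sL; rewrite mulmx_suml big_mkcond [RHS]big_mkcond.
apply: eq_bigr => x _; rewrite gv_gmx groupV.
case: (boolP (x \in Xset L K)) => xL.
  have [xgL xp] := (XsetP _ sL KL).1 xL.
  have -> : x \in Xset (Sset s) K.
    by apply/(XsetP _ (subxx _) KS); split=> //; apply: mem_gen_W xgL.
  by rewrite xgL.
case: ifP => // /(XsetP _ (subxx _) KS)[xW xp]; case: ifP => // xgL.
by case/negP: xL; apply/(XsetP _ sL KL).
Qed.

Lemma xel_top : xel L L = gv 1%g.
Proof.
rewrite /xel (_ : Xset L L = [set 1%g]) ?big_set1 ?invg1 //.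
apply/setP => x; rewrite in_set1; apply/idP/eqP => [/(XsetP _ sL (subxx _))[xL xp]|->]; last exact: X1.
apply: (Xset_gen1 sL (group1 _) xL) => i iL; last by rewrite mulg1; apply: xp.
by rewrite repr_mx1 mulmx1; apply: al_pos.
Qed.

(** Left multiplication by x^-1 permutes each [Xset (Sset s) K] with K inside L, so every such x_K
    absorbs x, and e_L is a combination of them. *)
Lemma eel_N x : x \in N -> eel (Sset s) L *m rmul x = eel (Sset s) L.
Proof.
move=> xN; have [xW _ _] := NsetP cox rGs faith sL xN.
have X1S (E : {set gT}) : E \subset Sset s -> 1%g \in Xset (Sset s) E by apply: X1.
suff /eqP : eel (Sset s) L *m (rmul x - 1%:M) = 0.
  by rewrite mulmxBr mulmx1 subr_eq0 => /eqP.
apply: eel_vanish => // K KL; have KS := subset_trans KL sL.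
rewrite mulmxBr mulmx1; apply/eqP; rewrite subr_eq0; apply/eqP.
rewrite mulmx_suml [RHS](reindex_inj (mulgI x^-1%g)); apply: eq_big => [w|w _]; last first.
  by rewrite gv_rmul invMg invgK.
apply/idP/idP => /(XsetP _ (subxx _) KS)[wW wp]; apply/(XsetP _ (subxx _) KS).
  split=> [|i iK]; first by rewrite groupM ?groupV.
  have := bulky_al cox rGs faith sL bulky xN (subsetP KL _ iK) => e.
  rewrite rGM ?groupV // mulmxA -{1}e rGK //; exact: wp.
have wW' : w \in W by rewrite -(groupMl _ (groupVr xW)).
split=> // i iK; have := bulky_al cox rGs faith sL bulky xN (subsetP KL _ iK) => e.
by have := wp i iK; rewrite rGM ?groupV // mulmxA -{1}e rGK.
Qed.

Lemma Echar_local u x : u \in <<L>>%g -> x \in N ->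
  Echar (Sset s) L (u * x)%g = Echar L L u.
Proof.
move=> uL xN; rewrite /Echar; set e := eel L L; set g := eel (Sset s) L; apply/esym.
have X1S (E : {set gT}) : E \subset Sset s -> 1%g \in Xset (Sset s) E by apply: X1.
have X1L (E : {set gT}) : E \subset L -> 1%g \in Xset L E by apply: X1.
(* [F] is left multiplication by e_L, [F'] truncation to W_L followed by left multiplication by
   e_L^L; the scalars are the leading coefficients in [eel_lead]. *)
pose c1 : algC := (mKL L L L)%:R; pose c2 : algC := (mKL (Sset s) L L)%:R.
pose F := c1 *: Lm g; pose F' := c2 *: (resmx L *m Lm e).
(* c1 e_L^L is 1 modulo the x_J of W_L with J proper, and these are annihilated by e_L. *)
have eF : e *m F = g.
  rewrite -scalemxAr (eel_lead X1L (subxx L)); last first.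
    by move=> J JL; rewrite xel_Lm eel_Rmx0.
  by rewrite xel_top gv_gmx rmul1 mulmx1.
(* Truncation turns the x_J of W into those of W_L, which e_L^L annihilates for J proper and which
   is 1 for J = L. *)
have gF' : g *m F' = e.
  rewrite -scalemxAr (eel_lead X1S sL); last first.
    by move=> J JL; rewrite mulmxA xel_res ?(proper_sub JL) // xel_Lm eel_Rmx0.
  by rewrite mulmxA xel_res // xel_top gv_gmx rmul1 mulmx1.
have Fr w : F *m rmul w = rmul w *m F by rewrite -scalemxAl Lm_rmul scalemxAr.
have F'r w : w \in <<L>>%g -> F' *m rmul w = rmul w *m F'.
  by move=> wL; rewrite -scalemxAl -mulmxA Lm_rmul mulmxA resmx_rmul // -mulmxA scalemxAr.
pose U (a : 'rV[algC]_#|gT|) : 'M[algC]_#|gT| := (\sum_(z in <<L>>%g) <<a *m rmul z>>)%MS.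
have U0 (a : 'rV_#|gT|) (M : 'M[algC]_#|gT|) : (forall z, z \in <<L>>%g -> a *m rmul z *m M = 0) -> U a *m M = 0.
  move=> aM; apply/eqP; rewrite -submx0 sumsmxMr; apply/sumsmx_subP => z zL.
  by rewrite (eqmxMr M (genmxE _)) aM // sub0mx.
have Ueq (a : 'rV_#|gT|) (M M' : 'M[algC]_#|gT|) :
    (forall z, z \in <<L>>%g -> a *m rmul z *m M = a *m rmul z *m M') -> U a *m M = U a *m M'.
  move=> aM; apply/eqP; rewrite -subr_eq0 -mulmxBr U0 // => z zL.
  by rewrite mulmxBr aM // subrr.
apply: (@tr_on_iso _ _ _ _ _ F F').
- rewrite sumsmxMr; apply/sumsmx_subP => z zL; rewrite (eqmxMr _ (genmxE _)) -mulmxA rmulM.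
  by apply: (sumsmx_sup (z * u)%g); rewrite ?groupM // genmxE.
- apply: eqmx_trans (sumsmxMr _ _ _) _; apply: eqmx_sums => z zL.
  apply: eqmx_trans (eqmxMr _ (genmxE _)) _; rewrite -mulmxA -Fr mulmxA eF.
  exact: eqmx_sym (genmxE _).
- rewrite -mulmxA -[RHS]mulmx1; apply: Ueq => z zL; rewrite mulmx1 !mulmxA.
  by rewrite -(mulmxA e) -Fr mulmxA eF -mulmxA -F'r // mulmxA gF'.
rewrite -!mulmxA; apply: Ueq => z zL; rewrite !mulmxA -!(mulmxA e) rmulM -!Fr !mulmxA eF.
rewrite -mulmxA rmulM mulgA.
have -> : (z * u * x = x * (z * u))%g.
  by apply/esym; apply: (centP (subsetP bulky x xN)); rewrite groupM.
by rewrite -rmulM mulmxA eel_N.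
Qed.

End Localize.
End Descent.

(** * Extension to the normalizer *)

Section DirectProduct.
Variables (gT : finGroupType) (G K H C D : {group gT}).
Hypotheses (KxH : (K \x H)%g = G) (CxH : (C \x H)%g = D) (sCK : C \subset K).

Lemma cfDprodl_out (f : 'CF(C)) k h : k \in K -> h \in H -> cfDprodl CxH f (k * h)%g = f k.
Proof.
move=> kK hH; have [kC|kC] := boolP (k \in C); first exact: cfDprodEl.
rewrite (cfun0 f kC) cfun0 //; apply: contra kC.
have [_ KH1 cKH tiKH] := dprodP KxH; have [_ CH1 _ _] := dprodP CxH.
rewrite -CH1 => /mulsgP[c h' cC h'H e].
by rewrite -(divgrMid tiKH kK hH) e (divgrMid tiKH) // (subsetP sCK).
Qed.

(** Conjugation by v z turns u x into u^v x^z, where the extended character depends on u^v alone;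
    the sum over z contributes |H|, which cancels in |D| = |C| |H|. *)
Lemma cfInd_dprodl (f : 'CF(C)) u x : u \in K -> x \in H ->
  'Ind[G] (cfDprodl CxH f) (u * x)%g = 'Ind[K] f u.
Proof.
move=> uK xH; have [_ KHG cKH tiKH] := dprodP KxH; have [_ CHD _ _] := dprodP CxH.
have sDG : D \subset G by rewrite -CHD -KHG mulSg.
rewrite !cfIndE //.
have -> : \sum_(y in G) cfDprodl CxH f ((u * x) ^ y)%g =
          \sum_(v in K) \sum_(z in H) cfDprodl CxH f ((u * x) ^ (v * z))%g.
  rewrite pair_big /= (reindex_onto (fun p : gT * gT => (p.1 * p.2)%g)
    (fun y => (divgr K H y, remgr K H y))) /=; last by move=> y _; rewrite -divgr_eq.
  apply: eq_bigl => -[v z] /=; apply/andP/andP => [[vzG /eqP[e1 e2]] | [vK zH]].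
    rewrite -KHG in vzG; have := mem_divgr vzG; rewrite e1 => ->.
    by have := mem_remgr vzG; rewrite e2 => ->.
  by rewrite (divgrMid tiKH) // (remgrMid tiKH) // -KHG mem_mulg.
have -> : \sum_(v in K) \sum_(z in H) cfDprodl CxH f ((u * x) ^ (v * z))%g =
          #|H|%:R * \sum_(v in K) f (u ^ v)%g.
  rewrite mulr_sumr; apply: eq_bigr => v vK.
  rewrite (eq_bigr (fun=> f (u ^ v)%g)) ?sumr_const ?mulr_natl // => z zH.
  have uvK : (u ^ v)%g \in K by rewrite groupJ.
  have -> : ((u * x) ^ (v * z) = u ^ v * x ^ z)%g.
    have xv : (x ^ v = x)%g by apply/conjg_fixP/commgP; apply: (centsP cKH).
    have uvz : ((u ^ v) ^ z = u ^ v)%g.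
      by apply/conjg_fixP/commgP/commute_sym; apply: (centsP cKH).
    by rewrite conjMg !conjgM xv uvz.
  by rewrite cfDprodl_out // groupJ.
rewrite mulrA; congr (_ * _); rewrite -(dprod_card CxH) natrM invfM -mulrA mulVf ?mulr1 //.
by rewrite pnatr_eq0 -lt0n cardG_gt0.
Qed.

End DirectProduct.

Section OSLocal.
Variables (gT : finGroupType) (n : nat) (s : 'I_n -> gT) (m : 'I_n -> 'I_n -> nat).
Variable rG : mx_representation algC (Wgrp s) n.
Hypotheses (cox : coxeter_matrix m) (rGs : forall i, rG (s i) = refl_mx m i).
Hypothesis faith : mx_faithful rG.
Variables (L : {set gT}) (sL : L \subset Sset s).
Hypothesis bulky : Nset (Sset s) L \subset ('C(<<L>>))%g.

Lemma refls_conj (A : {set gT}) g : g \in <<A>>%g -> (refls A :^ g)%g \subset refls A.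
Proof.
move=> gA; apply/subsetP => _ /imsetP[_ /imset2P[t w tA wA ->] ->].
by rewrite -conjgM imset2_f ?groupM.
Qed.

Lemma OSchar_parabolic u x : u \in <<L>>%g -> x \in Nset (Sset s) L ->
  OSchar rG (refls (Sset s)) (Fixmx rG L) (u * x)%g = OSchar rG (refls L) (Fixmx rG L) u.
Proof.
move=> uL xN; have uW := mem_gen_W sL uL; have [xW _ _] := NsetP cox rGs faith sL xN.
have eq_conj t : t \in refls L -> (t ^ (u * x) = t ^ u)%g.
  move=> /(subsetP (refls_gen L)) tL; rewrite conjgM; apply/conjg_fixP/commgP/commute_sym.
  by apply: (centP (subsetP bulky x xN)); rewrite groupJ.
have uN : u \in ('N(<<L>>))%g by apply: (subsetP (normG <<L>>%G)).
have TW : refls (Sset s) \subset Wgrp s := refls_gen _.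
have uxW : (u * x)%g \in Wgrp s by apply: groupM.
apply: (OSchar_local TW (reflsS sL) _ uxW uW _ _ _ _ _ eq_conj).
(* A reflection fixing Fix(W_L) pointwise lies in W_L by [Fix_stab], and [refls_parabolic] makes it
   W_L-conjugate to an element of L. *)
- move=> t tT; apply/idP/idP => [/(subsetP (refls_gen L)) tL | Xt].
    by apply/sub_kermxP; rewrite mulmxBr mulmx1; have /sub_Fixmx -> := submx_refl (Fixmx rG L);
       rewrite ?subrr.
  apply: (refls_parabolic cox rGs faith sL tT).
  apply: (Fix_stab cox rGs faith sL) => [|v fv]; first exact: (subsetP (refls_gen _) _ tT).
  have vX : (v <= Fixmx rG L)%MS by apply/sub_Fixmx.
  have /sub_kermxP/eqP := submx_trans vX Xt.
  by rewrite mulmxBr mulmx1 subr_eq0 => /eqP.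
- by apply: refls_conj; apply: groupM.
- apply/subsetP => _ /imsetP[t tL ->]; rewrite eq_conj //.
  by apply: (subsetP (refls_conj uL)); rewrite memJ_conjg.
- exact: refls_conj.
- apply: Fix_norm => //; rewrite inE groupM //=.
  exact: groupM uN (subsetP (N_norm cox rGs faith sL) x xN).
by apply: Fix_norm => //; rewrite inE uW.
Qed.

End OSLocal.

Theorem theorem4p8 (gT : finGroupType) (n : nat) (s : 'I_n -> gT)
    (m : 'I_n -> 'I_n -> nat) (rG : mx_representation algC (Wgrp s) n)
    (L : {set gT}) (rep : {set gT} -> gT)
    (phi psi : forall w : gT, 'CF('C_(<<L>>%G)[w]%G)) :
  coxeter_matrix m ->
  injective s ->
  (forall i, rG (s i) = refl_mx m i) ->
  mx_faithful rG ->
  L \subset Sset s ->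
  (* W_L is bulky: N_L centralizes W_L *)
  Nset (Sset s) L \subset ('C(<<L>>))%g ->
  (* fixed representatives of the W_L-classes *)
  (forall C, C \in classes <<L>>%g -> rep C \in C) ->
  (forall C, C \in classes <<L>>%g -> cuspidal m rG L (rep C) ->
     [/\ phi (rep C) \is a linear_char, psi (rep C) \is a linear_char
       & forall x, x \in ('C_(<<L>>%g)[rep C])%g ->
           psi (rep C) x = phi (rep C) x * sgn (Sset s) x]) ->
  (forall w, w \in <<L>>%g ->
     Echar L L w =
     (\sum_(C in classes <<L>>%g | cuspidal m rG L (rep C))
        'Ind[<<L>>%G] (phi (rep C))) w) ->
  (forall w, w \in <<L>>%g ->
     OSchar rG (refls L) (Fixmx rG L) w =
     (\sum_(C in classes <<L>>%g | cuspidal m rG L (rep C))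
        'Ind[<<L>>%G] (psi (rep C))) w) ->
  exists phit psit : forall w : gT, 'CF('C_(Wgrp s)[w]%G),
    (forall C, C \in classes <<L>>%g -> cuspidal m rG L (rep C) ->
      [/\ ('C_(Wgrp s)[rep C])%g = ('C_(<<L>>%g)[rep C] \x Nset (Sset s) L)%g,
          phit (rep C) \is a linear_char, psit (rep C) \is a linear_char,
          (forall c x, c \in ('C_(<<L>>%g)[rep C])%g -> x \in Nset (Sset s) L ->
             phit (rep C) (c * x)%g = phi (rep C) c
             /\ psit (rep C) (c * x)%g = psi (rep C) c)
        & forall x, x \in ('C_(Wgrp s)[rep C])%g ->
             psit (rep C) x = phit (rep C) x * sgn (Sset s) x * alphaL rG L x])
    /\ (forall x, x \in ('N_(Wgrp s)(<<L>>))%g ->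
          Echar (Sset s) L x =
          (\sum_(C in classes <<L>>%g | cuspidal m rG L (rep C))
             'Ind['N_(Wgrp s)(<<L>>%g)%G] (phit (rep C))) x)
    /\ (forall x, x \in ('N_(Wgrp s)(<<L>>))%g ->
          OSchar rG (refls (Sset s)) (Fixmx rG L) x =
          (\sum_(C in classes <<L>>%g | cuspidal m rG L (rep C))
             'Ind['N_(Wgrp s)(<<L>>%g)%G] (psit (rep C))) x).
Proof.
move=> cox inj_s rGs faith sL bulky repP linP EcharE OSE.
pose N := Ngroup cox rGs faith sL.
(* [cfDprodl] takes a proof of the decomposition of C_W(w), available for cuspidal w; the value 0
   elsewhere makes [ext] total. *)
pose ext (f : forall w : gT, 'CF('C_(<<L>>%G)[w]%G)) w : 'CF('C_(Wgrp s)[w]%G) :=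
  match @eqP _ ('C_(<<L>>%G)[w]%G \x N)%g ('C_(Wgrp s)[w]%G : {set gT}) with
  | ReflectT e => cfDprodl e (f w)
  | ReflectF _ => 0
  end.
have extE f w : cuspidal m rG L w ->
    exists e : ('C_(<<L>>%G)[w]%G \x N)%g = 'C_(Wgrp s)[w]%G, ext f w = cfDprodl e (f w).
  move=> cw; rewrite /ext; case: eqP => [e|ne]; first by exists e.
  by case: ne; apply: (cent_dprod cox rGs faith sL bulky cw).
have nLN : (<<L>>%G \x N)%g = 'N_(Wgrp s)(<<L>>%g)%G := norm_dprod cox rGs faith sL bulky.
have decN x : x \in ('N_(Wgrp s)(<<L>>))%g -> exists u y, [/\ u \in <<L>>%g, y \in N & x = (u * y)%g].
  by have [_ <- _ _] := dprodP nLN => /mulsgP[u y uL yN ->]; exists u, y.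
have IndE f u y : u \in <<L>>%g -> y \in N ->
    (\sum_(C in classes <<L>>%g | cuspidal m rG L (rep C))
       'Ind['N_(Wgrp s)(<<L>>%g)%G] (ext f (rep C))) (u * y)%g =
    (\sum_(C in classes <<L>>%g | cuspidal m rG L (rep C)) 'Ind[<<L>>%G] (f (rep C))) u.
  move=> uL yN; rewrite !sum_cfunE; apply: eq_bigr => C /andP[_ cC].
  have [e ->] := extE f _ cC.
  by apply: (cfInd_dprodl nLN e) => //; apply: subsetIl.
exists (ext phi), (ext psi); split; [|split].
- move=> C Ccl cC; have [lphi lpsi psiE] := linP C Ccl cC.
  have [e1 E1] := extE phi _ cC; have [e2 E2] := extE psi _ cC.
  have val c x : c \in ('C_(<<L>>%g)[rep C])%g -> x \in Nset (Sset s) L ->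
      ext phi (rep C) (c * x)%g = phi (rep C) c /\ ext psi (rep C) (c * x)%g = psi (rep C) c.
    by move=> cC' xN; rewrite E1 E2; split; apply: cfDprodEl.
  split=> //.
  + by rewrite E1 cfDprodl_lin_char.
  + by rewrite E2 cfDprodl_lin_char.
  move=> x xC; have [_ CN _ _] := dprodP e1.
  have /mulsgP[c y cCL yN ->] : x \in ('C_(<<L>>%G)[rep C]%G * N)%g by rewrite CN.
  have [-> ->] := val c y cCL yN; have cL : c \in <<L>>%g by case/setIP: cCL.
  (* The determinant of y enters both the sign and alpha_L and squares to 1, which leaves the sign
     of c. *)
  by rewrite -mulrA (sgn_alphaL cox rGs faith sL bulky cL yN) psiE.
- move=> x /decN[u [y [uL yN ->]]]; rewrite IndE // -EcharE //.
  exact: (Echar_local cox rGs faith sL bulky).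
move=> x /decN[u [y [uL yN ->]]]; rewrite IndE // -OSE //.
exact: (OSchar_parabolic cox rGs faith sL bulky).
Qed.
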